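(* Let $X$ be a (nonempty) locally compact Hausdorff space and $L:X\times X\to[1,\infty)$ a continuous log-conditional kernel. Let $H_{L}:X\times X\to\mathbb{R}$, $H_{L}(x,y):=L(x,y)^{-1}$, and let $\mathcal{H}_{H_{L}}$ be its reproducing kernel Hilbert space. Then $H_{L}$ is $C_{0}(X)$-universal if and only if $L$ is metrizable and $\mathcal{H}_{H_{L}}\subset C_{0}(X)$. Further, there exists $z_{0}\in X$ for which the function $x\mapsto L(x,z_{0})^{-1}$ is an element of $C_{0}(X)$ if and only if $\mathcal{H}_{H_{L}}\subset C_{0}(X)$.
   Context: A kernel $\gamma:X\times X\to\mathbb{R}$ is conditionally negative definite if $\gamma(x,y)=\gamma(y,x)$ and $\sum_{\mu,\nu=1}^{n}c_{\mu}c_{\nu}\gamma(x_{\mu},x_{\nu})\le 0$ for all finitely many distinct points $x_{1},\dots,x_{n}$ and $c_{1},\dots,c_{n}\in\mathbb{R}$ with $\sum_{\mu}c_{\mu}=0$. Such a $\gamma$ is metrizable if $2\gamma(x,y)>\gamma(x,x)+\gamma(y,y)$ for all $x\neq y$ in $X$. A symmetric kernel $L:X\times X\to[1,\infty)$ is log-conditional if $\log L(x,y)$ is conditionally negative definite; a log-conditional kernel $L$ is metrizable if $\log L$ is metrizable. A kernel $K:X\times X\to\mathbb{C}$ is positive definite if $\sum_{\mu,\nu=1}^{n}c_{\mu}\overline{c_{\nu}}K(x_{\mu},x_{\nu})\ge 0$ for all finitely many distinct points $x_{\mu}\in X$ and scalars $c_{\mu}\in\mathbb{C}$. Its reproducing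 kernel Hilbert space $\mathcal{H}_{K}$ is the Hilbert space of functions $F:X\to\mathbb{C}$ that contains $K_{y}:=K(\cdot,y)$ for every $y\in X$, satisfies $\langle F,K_{y}\rangle_{\mathcal{H}_{K}}=F(y)$, and in which $\mathrm{span}\{K_{y}:y\in X\}$ is dense. $C_{0}(X)$ is the Banach space (sup norm) of continuous $f:X\to\mathbb{C}$ such that for every $\epsilon>0$ there is a compact set outside of which $|f|<\epsilon$. A positive definite kernel $K$ is $C_{0}$-universal (also written $C_{0}(X)$-universal) if $\mathcal{H}_{K}\subset C_{0}(X)$ and for every $g\in C_{0}(X)$ and $\epsilon>0$ there is $f\in\mathcal{H}_{K}$ with $\sup_{x\in X}|f(x)-g(x)|<\epsilon$. *)

(* Defs.v *)
(* MathComp / MathComp-Analysis; the complex numbers over R are R[i]. *)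
From HB Require Import structures.
From mathcomp Require Import all_boot all_order all_algebra complex.
From mathcomp Require Import all_classical all_reals all_analysis.

Set Implicit Arguments.
Unset Strict Implicit.
Unset Printing Implicit Defensive.

Import Order.TTheory GRing.Theory Num.Theory.
Import numFieldNormedType.Exports.
Import ComplexField.

Local Open Scope classical_set_scope.
Local Open Scope ring_scope.

Section Kernels.
Context {R : realType} {X : Type}.

Definition cond_neg_def (g : X -> X -> R) : Prop :=
  (forall x y, g x y = g y x) /\
  forall (n : nat) (x : 'I_n -> X) (c : 'I_n -> R),
    injective x -> \sum_i c i = 0 ->
    \sum_i \sum_j c i * c j * g (x i) (x j) <= 0.

Definition metrizable (g : X -> X -> R) : Prop :=
  forall x y, x <> y -> g x x + g y y < 2 * g x y.

Definition log_kernel (L : X -> X -> R) : X -> X -> R := fun x y => ln (L x y).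

Definition log_conditional (L : X -> X -> R) : Prop :=
  [/\ forall x y, 1 <= L x y,
      forall x y, L x y = L y x &
      cond_neg_def (log_kernel L)].

Definition log_metrizable (L : X -> X -> R) : Prop :=
  metrizable (log_kernel L).

(* The order of R[i] makes [0 <= z] mean that z is real and nonnegative. *)
Definition positive_definite (K : X -> X -> R[i]) : Prop :=
  forall (n : nat) (x : 'I_n -> X) (c : 'I_n -> R[i]),
    injective x ->
    0 <= \sum_i \sum_j c i * (c j)^*%C * K (x i) (x j).

Definition inverse_kernel (L : X -> X -> R) : X -> X -> R[i] :=
  fun x y => ((L x y)^-1)%:C%C.

Definition ip_norm (ip : (X -> R[i]) -> (X -> R[i]) -> R[i])
  (F : X -> R[i]) : R := Num.sqrt (complex.Re (ip F F)).

(* [ip] is only meaningful on [H]; it is linear in its first argument. *)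
Record is_rkhs (K : X -> X -> R[i]) (H : set (X -> R[i]))
    (ip : (X -> R[i]) -> (X -> R[i]) -> R[i]) : Prop := IsRKHS {
  rkhs_zero : H 0 ;
  rkhs_linear : forall (a : R[i]) F G, H F -> H G -> H (a *: F + G) ;
  rkhs_ip_linear : forall (a : R[i]) F G E, H F -> H G -> H E ->
    ip (a *: F + G) E = a * ip F E + ip G E ;
  rkhs_ip_conj : forall F G, H F -> H G -> ip G F = (ip F G)^*%C ;
  rkhs_ip_ge0 : forall F, H F -> 0 <= ip F F ;
  rkhs_ip_eq0 : forall F, H F -> ip F F = 0 -> F = 0 ;
  rkhs_complete : forall u : nat -> X -> R[i], (forall n, H (u n)) ->
    (forall e : R, 0 < e -> exists N : nat, forall m n : nat,
       (N <= m)%N -> (N <= n)%N -> ip_norm ip (u m - u n) < e) ->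
    exists2 F, H F & (fun n => ip_norm ip (u n - F)) @ \oo --> (0 : R) ;
  rkhs_kernel : forall y, H (K^~ y) ;
  rkhs_reproducing : forall F y, H F -> ip F (K^~ y) = F y ;
  rkhs_dense : forall F (e : R), H F -> 0 < e ->
    exists (n : nat) (a : 'I_n -> R[i]) (y : 'I_n -> X),
      ip_norm ip (F - \sum_i a i *: K^~ (y i)) < e
}.

(* "The" reproducing kernel Hilbert space: [is_rkhs K H ip] determines [H] from
   [K], and such an [H] exists as soon as [K] is positive definite
   (Moore-Aronszajn).  The default value [set0] is only taken otherwise. *)
Definition rkhs (K : X -> X -> R[i]) : set (X -> R[i]) :=
  xget set0 [set H | exists ip, is_rkhs K H ip].

End Kernels.

Section Universality.
Context {R : realType} {X : topologicalType}.

(* [R[i]^o] carries the topology of the modulus; [R[i]] itself has none. *)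
Definition C0 : set (X -> R[i]) :=
  [set f | continuous (f : X -> R[i]^o) /\
    forall e : R, 0 < e ->
      exists2 A : set X, compact A &
        forall x, ~ A x -> Normc.normc (f x) < e].

(* An extended-real supremum, as the real one is 0 on unbounded sets. *)
Definition sup_dist (f g : X -> R[i]) : \bar R :=
  ereal_sup (range (fun x => (Normc.normc (f x - g x))%:E)).

Definition C0_universal (K : X -> X -> R[i]) : Prop :=
  [/\ positive_definite K,
      rkhs K `<=` C0 &
      forall (g : X -> R[i]) (e : R), C0 g -> 0 < e ->
        exists2 f, rkhs K f & (sup_dist f g < e%:E)%E].

End Universality.

Arguments C0 R X : clear implicits.

(* Main.v *)
(* Write [g = log L] and [H_L = exp (- g)].  Schoenberg's theorem makes [H_L]
   positive definite, and more is true: for a base point [z] and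
   [theta u = t * (g u x - g u y) + d], adjoining to [X] a point whose inner
   product with [H_L(., u)] is [H_L u z * sin (theta u)] keeps the kernel positive
   definite, as one sees by expanding [exp] and [sin] into power series and using
   Schur's product theorem degree by degree.  Hence [H_L(., z) * sin theta] lies in
   the RKHS, for all [z]: the uniform closure of the RKHS is stable under
   multiplication by the bounded functions [sin theta].  When [L] is metrizable
   they separate points, and a weighted Stone-Weierstrass theorem for the algebra of
   multipliers, with weight [H_L(., z)], gives density in [C_0(X)].  When it is
   not, [H_L(., x)] and [H_L(., y)] are proportional for some [x <> y], so that
   the values at [x] and [y] are proportional on the whole RKHS. *)
Require Import Defs.
From HB Require Import structures.
From mathcomp Require Import all_boot all_order all_algebra complex.
From mathcomp Require Import all_classical all_reals all_analysis.
From mathcomp Require Import ring lra.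

Set Implicit Arguments.
Unset Strict Implicit.

Import Order.TTheory GRing.Theory Num.Theory.
Import numFieldNormedType.Exports.

Local Open Scope classical_set_scope.
Local Open Scope ring_scope.

(** Sine qualifies because its Taylor coefficients are at most those of [exp] in absolute value: in
    each degree, the two-by-two matrix with diagonal 1 and with the quotient of the two coefficients
    off the diagonal is positive semidefinite. As sine is also bounded by 1, multiplying by it does
    not enlarge uniform errors, and [t], [d] can be tuned to give [theta] the values 0 and 1 at two
    prescribed points.

    [rkhs] is a choice, and it is never identified with an explicit space. A concrete space is built
    to show that the choice is not the default; after that only the axioms are used, together with
    finite kernel sums, which lie in every such space. Since the kernel is real, the analysis is
    done over the reals, where membership in the RKHS is a bound on a supremum and no abstract
    completion is needed.

    The second equivalence comes from negative definiteness at three points: it bounds the square of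
    one kernel section by a constant times any other section, so that a single section in [C0]
    brings in all of them. *)

(** * Finite real combinations of points and their quadratic forms *)

Section FiniteCombinations.
Context {R : realType} {T : Type}.
Implicit Types (F G : T -> R) (s t : seq (R * T)) (K : T -> T -> R).

(** A list of weighted points stands for a finitely supported measure. Points may repeat, so that
    addition is concatenation and no distinctness has to be maintained. *)
Definition pairing F s : R := \sum_(p <- s) p.1 * F p.2.

Definition combo K s : T -> R := fun x => \sum_(p <- s) p.1 * K x p.2.

Definition form K s t : R := pairing (combo K t) s.

Definition scale_combo (a : R) s : seq (R * T) :=
  [seq (a * p.1, p.2) | p <- s].

Lemma pairing_nil F : pairing F [::] = 0.
Proof. by rewrite /pairing big_nil. Qed.

Lemma pairing_cat F s t : pairing F (s ++ t) = pairing F s + pairing F t.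
Proof. by rewrite /pairing big_cat. Qed.

Lemma pairing1 F a x : pairing F [:: (a, x)] = a * F x.
Proof. by rewrite /pairing big_seq1. Qed.

Lemma pairing_scale F a s : pairing F (scale_combo a s) = a * pairing F s.
Proof.
by rewrite /pairing big_map mulr_sumr; apply: eq_bigr => p _ /=; rewrite mulrA.
Qed.

Lemma eq_pairing F G s : F =1 G -> pairing F s = pairing G s.
Proof. by move=> FG; apply: eq_bigr => p _; rewrite FG. Qed.

Lemma pairing_linear (a b : R) F G s :
  pairing (fun x => a * F x + b * G x) s = a * pairing F s + b * pairing G s.
Proof.
rewrite /pairing !mulr_sumr -big_split; apply: eq_bigr => p _ /=; ring.
Qed.

Lemma combo_nil K x : combo K [::] x = 0.
Proof. by rewrite /combo big_nil. Qed.

Lemma combo_cat K s t x : combo K (s ++ t) x = combo K s x + combo K t x.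
Proof. by rewrite /combo big_cat. Qed.

Lemma combo1 K a x y : combo K [:: (a, y)] x = a * K x y.
Proof. by rewrite /combo big_seq1. Qed.

Lemma combo_scale K a s x : combo K (scale_combo a s) x = a * combo K s x.
Proof.
by rewrite /combo big_map mulr_sumr; apply: eq_bigr => p _ /=; rewrite mulrA.
Qed.

Lemma form_catl K s s' t : form K (s ++ s') t = form K s t + form K s' t.
Proof. exact: pairing_cat. Qed.

Lemma form_catr K s t t' : form K s (t ++ t') = form K s t + form K s t'.
Proof.
rewrite /form -[pairing (combo K t) s]mul1r -[pairing (combo K t') s]mul1r.
by rewrite -pairing_linear; apply: eq_pairing => x; rewrite combo_cat !mul1r.
Qed.

Lemma form_scalel K a s t : form K (scale_combo a s) t = a * form K s t.
Proof. exact: pairing_scale. Qed.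

Lemma form_scaler K a s t : form K s (scale_combo a t) = a * form K s t.
Proof.
rewrite /form -[RHS]addr0 -[X in _ + X](mul0r (pairing (combo K t) s)).
rewrite -pairing_linear.
by apply: eq_pairing => x; rewrite combo_scale mul0r addr0.
Qed.

Lemma form_sym K : (forall x y, K x y = K y x) ->
  forall s t, form K s t = form K t s.
Proof.
move=> Ksym s t; rewrite /form /pairing /combo.
under eq_bigr do rewrite mulr_sumr.
rewrite exchange_big; apply: eq_bigr => p _; rewrite mulr_sumr.
by apply: eq_bigr => q _; rewrite Ksym !mulrA [p.1 * _]mulrC.
Qed.

Lemma form_eval K x y a b : form K [:: (a, x)] [:: (b, y)] = a * b * K x y.
Proof. by rewrite /form pairing1 combo1 mulrA. Qed.

Lemma form_sum K s t :
  form K s t = \sum_(p <- s) \sum_(q <- t) p.1 * q.1 * K p.2 q.2.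
Proof.
rewrite /form /pairing /combo; apply: eq_bigr => p _; rewrite mulr_sumr.
by apply: eq_bigr => q _; rewrite mulrA.
Qed.

Definition pd_kernel K :=
  (forall x y, K x y = K y x) /\ forall s, 0 <= form K s s.

End FiniteCombinations.

(** * Positive definite kernels and Schur's product theorem *)

Section PositiveDefiniteKernels.
Context {R : realType}.

Lemma discriminant_le (A B C : R) :
  (forall a b : R, 0 <= a ^+ 2 * A + 2 * a * b * B + b ^+ 2 * C) ->
  B ^+ 2 <= A * C.
Proof.
move=> H; have C0 : 0 <= C by have := H 0 1; rewrite !(expr0n, expr1n) /=; lra.
have [C_eq0|C_neq0] := eqVneq C 0; last first.
  have C_gt0 : 0 < C by rewrite lt_def C_neq0.
  rewrite -subr_ge0 -(pmulr_rge0 _ C_gt0).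
  rewrite [leRHS](_ : _ = C ^+ 2 * A + 2 * C * (- B) * B + (- B) ^+ 2 * C) //.
  ring.
have [->|B_neq0] := eqVneq B 0; first by rewrite C_eq0 expr0n mulr0.
(* With [C = 0] the form is affine in [b]; this [b] gives it the value -1. *)
have := H 1 (- (A + 1) / B / 2).
rewrite [leRHS](_ : _ = - 1 + C * ((A + 1) / B / 2) ^+ 2); last by field.
by rewrite C_eq0; lra.
Qed.

Lemma form_cauchy_schwarz {T : Type} (K : T -> T -> R) s t : pd_kernel K ->
  form K s t ^+ 2 <= form K s s * form K t t.
Proof.
move=> [Ksym Kge0]; apply: discriminant_le => a b.
have := Kge0 (scale_combo a s ++ scale_combo b t).
rewrite !form_catl !form_catr !form_scalel !form_scaler.
by rewrite (form_sym Ksym t s); lra.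
Qed.

Lemma pd_diag_ge0 {T : Type} {K : T -> T -> R} x : pd_kernel K -> 0 <= K x x.
Proof. by move=> [_ /(_ [:: (1, x)])]; rewrite form_eval !mul1r. Qed.

Lemma pd_kernel_add {T : Type} (A B : T -> T -> R) :
  pd_kernel A -> pd_kernel B -> pd_kernel (fun x y => A x y + B x y).
Proof.
move=> [Asym A0] [Bsym B0]; split=> [x y|s]; first by rewrite Asym Bsym.
rewrite [leRHS](_ : _ = form A s s + form B s s) ?addr_ge0//.
rewrite !form_sum -big_split; apply: eq_bigr => p _; rewrite -big_split.
by apply: eq_bigr => q _ /=; rewrite mulrDr.
Qed.

Lemma pd_kernel_scale {T : Type} (a : R) (A : T -> T -> R) :
  0 <= a -> pd_kernel A -> pd_kernel (fun x y => a * A x y).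
Proof.
move=> a0 [Asym A0]; split=> [x y|s]; first by rewrite Asym.
rewrite [leRHS](_ : _ = a * form A s s) ?mulr_ge0//.
rewrite !form_sum mulr_sumr; apply: eq_bigr => p _; rewrite mulr_sumr.
by apply: eq_bigr => q _ /=; rewrite mulrCA.
Qed.

Lemma pd_kernel_rank1 {T : Type} (f : T -> R) :
  pd_kernel (fun x y => f x * f y).
Proof.
split=> [x y|s]; first by rewrite mulrC.
rewrite [leRHS](_ : _ = pairing f s ^+ 2) ?sqr_ge0//.
rewrite form_sum /pairing expr2 mulr_suml; apply: eq_bigr => p _.
by rewrite mulr_sumr; apply: eq_bigr => q _ /=; rewrite mulrACA.
Qed.

Lemma cvg_seq_sum {I : Type} (s : seq I) (u : I -> nat -> R) (l : I -> R) :
  (forall i, u i @ \oo --> l i) ->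
  (fun n => \sum_(i <- s) u i n) @ \oo --> \sum_(i <- s) l i.
Proof.
move=> ul; elim: s => [|i s IH].
  by rewrite big_nil; under eq_fun do rewrite big_nil; exact: cvg_cst.
by rewrite big_cons; under eq_fun do rewrite big_cons; exact: cvgD.
Qed.

Lemma pd_kernel_cvg {T : Type} (A : nat -> T -> T -> R) (B : T -> T -> R) :
  (forall n, pd_kernel (A n)) ->
  (forall x y, (fun n => A n x y) @ \oo --> B x y) -> pd_kernel B.
Proof.
move=> Apd AB; split=> [x y|s].
  have := AB y x; rewrite (_ : (fun n => A n y x) = fun n => A n x y).
    by apply: cvg_unique => //; exact: AB.
  by apply/funext => n; exact: (Apd n).1.
have fcvg : (fun n => form (A n) s s) @ \oo --> form B s s.
  rewrite form_sum; under eq_fun do rewrite form_sum.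
  by apply: cvg_seq_sum => p; apply: cvg_seq_sum => q; exact: cvgMl_tmp.
rewrite -(cvg_lim _ fcvg)//; apply: limr_ge; first by apply/cvg_ex;
  exists (form B s s).
by apply: nearW => n; exact: (Apd n).2.
Qed.

Definition flatten_combo {S T : Type} (l : S -> seq (R * T)) (s : seq (R * S)) :
  seq (R * T) := flatten [seq scale_combo p.1 (l p.2) | p <- s].

Lemma pairing_flatten {S T : Type} (l : S -> seq (R * T)) (F : T -> R) s :
  pairing F (flatten_combo l s) = pairing (fun p => pairing F (l p)) s.
Proof.
elim: s => [|p s IH]; first by rewrite /pairing !big_nil.
rewrite /flatten_combo /= pairing_cat pairing_scale.
by rewrite -/(flatten_combo l s) IH /pairing big_cons.
Qed.

(** The new kernel is the Gram kernel of the vectors represented by the lists [l p]. It allows an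
    added point to stand for a difference of kernel sections. *)
Lemma pd_kernel_pullback {S T : Type} (K : T -> T -> R) (l : S -> seq (R * T)) :
  pd_kernel K -> pd_kernel (fun p q => form K (l p) (l q)).
Proof.
move=> [Ksym K0]; split=> [p q|s]; first exact: form_sym.
rewrite [leRHS](_ : _ = form K (flatten_combo l s) (flatten_combo l s))//.
rewrite [RHS]/form [RHS]pairing_flatten; apply: eq_pairing => p.
rewrite -[RHS]/(form K _ _) (form_sym Ksym) /form pairing_flatten.
by apply: eq_bigr => q _; rewrite -/(form K _ _) (form_sym Ksym).
Qed.

(** A Schur complement: the part of the kernel orthogonal to the section at [p]. If [K p p = 0], the
    quotient is 0 by convention, and Cauchy-Schwarz shows that the row of [p] was already zero. *)
Lemma pd_kernel_reduce {T : Type} (K : T -> T -> R) (p : T) : pd_kernel K ->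
  pd_kernel (fun x y => K x y - K x p * K p y / K p p) /\
  forall y, K p y - K p p * K p y / K p p = 0.
Proof.
move=> Kpd; have [Ksym K0] := Kpd; split=> [|y]; last first.
  have [Kp0|Kp0] := eqVneq (K p p) 0; last by rewrite mulrAC divff// mul1r subrr.
  rewrite Kp0 mul0r mul0r subr0; apply/eqP.
  have := form_cauchy_schwarz [:: (1, p)] [:: (1, y)] Kpd.
  by rewrite !form_eval Kp0 !mul1r mul0r -sqrf_eq0 eq_le sqr_ge0 andbT.
split=> [x y|s]; first by rewrite !(Ksym p) [K x p * _]mulrC (Ksym x).
rewrite [leRHS](_ : _ = form K s s - form K s [:: (1, p)] ^+ 2 / K p p).
  have := form_cauchy_schwarz s [:: (1, p)] Kpd.
  rewrite form_eval !mul1r => CS.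
  have [->|Kp0] := eqVneq (K p p) 0; first by rewrite invr0 mulr0 subr0.
  have Kp_gt0 : 0 < K p p by rewrite lt_def Kp0 pd_diag_ge0.
  by rewrite subr_ge0 ler_pdivrMr.
rewrite !form_sum expr2 -mulrA mulr_suml -sumrB; apply: eq_bigr => q _.
rewrite big_seq1 mulr_suml mulr_sumr -sumrB; apply: eq_bigr => r _ /=.
rewrite big_seq1 /= (Ksym p); ring.
Qed.

(** Cholesky elimination, with the points of [l] as successive pivots. *)
Lemma pd_kernel_finite_rank {T : eqType} (K : T -> T -> R) (l : seq T) :
  pd_kernel K -> exists (fs : seq (T -> R)) (K' : T -> T -> R),
    [/\ pd_kernel K', forall x y, x \in l -> K' x y = 0 &
        forall x y, K x y = \sum_(f <- fs) f x * f y + K' x y].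
Proof.
move=> Kpd; elim: l => [|p l [fs [K' [K'pd K'0 KE]]]].
  by exists [::], K; split=> // x y; rewrite big_nil add0r.
have [K''pd K''0] := pd_kernel_reduce p K'pd.
exists ((fun x => K' x p / Num.sqrt (K' p p)) :: fs),
  (fun x y => K' x y - K' x p * K' p y / K' p p).
split=> // x y; last first.
  rewrite KE big_cons (K'pd.1 p y) -[in X in _ =
    _ + (_ - X)](sqr_sqrtr (pd_diag_ge0 p K'pd)).
  by rewrite -exprVn; ring.
rewrite inE => /orP[/eqP ->|xl]; first exact: K''0.
by rewrite !(K'0 x)// !mul0r subr0.
Qed.

(** On the support of [s], [B] is a sum of rank one kernels [f x * f y], and each factor [f] can be
    absorbed into the weights of [s], which leaves a form of [A]. *)
Lemma pd_kernel_mul {T : eqType} (A B : T -> T -> R) :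
  pd_kernel A -> pd_kernel B -> pd_kernel (fun x y => A x y * B x y).
Proof.
move=> [Asym A0] Bpd; split=> [x y|s]; first by rewrite Asym Bpd.1.
have [fs [B' [_ B'0 BE]]] := pd_kernel_finite_rank [seq p.2 | p <- s] Bpd.
rewrite [leRHS](_ : _ = \sum_(f <- fs) let u :=
  [seq (p.1 * f p.2, p.2) | p <- s] in form A u u).
  by apply: sumr_ge0.
rewrite form_sum /=.
under [RHS]eq_bigr => f _.
  rewrite form_sum big_map; under eq_bigr => p _ do rewrite big_map /=.
  over.
rewrite [RHS]exchange_big; apply: eq_big_seq => p ps.
rewrite [RHS]exchange_big; apply: eq_bigr => q _ /=.
rewrite BE B'0 ?map_f// addr0 !mulr_sumr.
by apply: eq_bigr => f _; ring.
Qed.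

Lemma pd_kernel_exp {T : eqType} (A : T -> T -> R) n :
  pd_kernel A -> pd_kernel (fun x y => A x y ^+ n).
Proof.
move=> Apd; elim: n => [|n IH].
  rewrite (_ : (fun _ => _) = fun x y => (fun=> 1 : R) x * (fun=> 1 : R) y);
    first exact: pd_kernel_rank1.
  by apply/funext => x; apply/funext => y; rewrite expr0 mulr1.
rewrite (_ : (fun _ => _) = fun x y => A x y * A x y ^+ n);
  first exact: pd_kernel_mul.
by apply/funext => x; apply/funext => y; rewrite exprS.
Qed.

End PositiveDefiniteKernels.

(** * Conditionally negative definite kernels and their exponentials *)

Section NegativeDefiniteKernels.
Context {R : realType}.

(** [cond_neg_def] tests distinct points only, so the weights that [s] places on equal points are
    merged. *)
Lemma cond_neg_def_combo {X : eqType} (g : X -> X -> R) (s : seq (R * X)) :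
  cond_neg_def g -> \sum_(p <- s) p.1 = 0 -> form g s s <= 0.
Proof.
move=> [gsym gneg] s0; pose l := undup [seq p.2 | p <- s].
pose x i := tnth (in_tuple l) i.
pose c i := \sum_(p <- s | p.2 == x i) p.1.
have pairE F : pairing F s = \sum_i c i * F (x i).
  rewrite -(big_tnth _ _ l xpredT (fun y => (\sum_(p <- s | p.2 == y) p.1) * F y)).
  under [RHS]eq_bigr => y _.
    rewrite mulr_suml big_mkcond /=.
    over.
  rewrite exchange_big; apply: eq_big_seq => p ps.
  rewrite (bigD1_seq p.2) ?undup_uniq ?mem_undup ?map_f//= eqxx.
  by rewrite big1 ?addr0// => y; rewrite eq_sym => /negPf ->.
have xinj : injective x by apply/tuple_uniqP; exact: undup_uniq.
have := gneg _ x c xinj; rewrite (_ : \sum_i c i = 0) => [/(_ erefl)|]; last first.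
  have := pairE (fun=> 1); rewrite /pairing.
  by under eq_bigr do rewrite mulr1; under [RHS]eq_bigr do rewrite mulr1;
    rewrite s0.
apply: le_trans; rewrite le_eqVlt (_ : form g s s == _)//; apply/eqP.
rewrite /form pairE; apply: eq_bigr => i _.
rewrite [combo g s _]pairE mulr_sumr.
by apply: eq_bigr => j _; rewrite mulrA.
Qed.

(** Schoenberg's transform: for [g] a squared Euclidean distance it is twice the inner product of
    [u - z] and [v - z]. *)
Definition centered {X : Type} (g : X -> X -> R) (z u v : X) : R :=
  g u z + g v z - g u v - g z z.

Lemma pd_centered {X : eqType} (g : X -> X -> R) z :
  cond_neg_def g -> pd_kernel (centered g z).
Proof.
move=> gcnd; have gsym := gcnd.1; split=> [u v|s].
  by rewrite /centered (gsym v u) [g v z + _]addrC.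
pose m := \sum_(p <- s) p.1.
(* The mass [- m] at [z] makes the total weight zero; the form of [g] on the enlarged list is then
   minus the form of [centered g z] on [s]. *)
have := @cond_neg_def_combo _ g (s ++ [:: (- m, z)]) gcnd.
rewrite big_cat big_seq1 /= subrr => /(_ erefl).
rewrite form_catl !form_catr (form_sym gsym [:: _]) form_eval.
have -> : form g s [:: (- m, z)] = - m * pairing (g^~ z) s.
  rewrite /form mulr_sumr; apply: eq_bigr => p _; rewrite combo1; ring.
suff -> : form (centered g z) s s =
  2 * m * pairing (g^~ z) s - form g s s - m ^+ 2 * g z z.
  by move=> H; lra.
have cE x : combo (centered g z) s x =
    m * g x z + 1 * (1 * (pairing (g^~ z) s + - g z z * m) + (-1) * combo g s x).
  rewrite /combo /pairing /m mulr_suml !mul1r !mulr_sumr -!big_split /=.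
  by apply: eq_bigr => p _; rewrite /centered /=; ring.
rewrite /form (eq_pairing _ cE) !pairing_linear.
have -> c : pairing (fun=> c) s = m * c.
  by rewrite /pairing mulr_suml.
rewrite /form; ring.
Qed.

(** The degree [k] term is [M ^+ k / k!] times [D k], whose off-diagonal blocks carry [eps k], that
    is, [k!] times the Taylor coefficient of sine. Schur's theorem applies once [D k] is positive
    definite. *)
Lemma pd_exp_sin {T : eqType} (M : T -> T -> R) (b : T -> bool) : pd_kernel M ->
  pd_kernel (fun p q => if b p == b q then expR (M p q) else sin (M p q)).
Proof.
move=> Mpd.
pose eps k : R := (odd k)%:R * (-1) ^+ k.-1./2.
have eps1 k : `|eps k| <= 1.
  by rewrite normrM normrX normrN1 expr1n mulr1; case: odd; rewrite ?normr1 ?normr0.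
pose D k p q : R := if b p == b q then 1 else eps k.
have Dpd k : pd_kernel (D k).
  pose v p : R := (-1) ^+ b p.
  (* Spectral decomposition of the matrix with diagonal 1 and off-diagonal [eps k]: eigenvectors (1,
     1) and (1, -1), eigenvalues [1 + eps k] and [1 - eps k]. *)
  rewrite (_ : D k = fun p q => (1 + eps k) / 2 * ((fun=> 1) p * (fun=> 1) q)
                              + (1 - eps k) / 2 * (v p * v q)); last first.
    apply/funext => p; apply/funext => q; rewrite /D /v.
    by case: (b p); case: (b q); rewrite /= ?expr0 ?expr1; field.
  have := eps1 k; rewrite ler_norml => /andP[e1 e2].
  by apply: pd_kernel_add; apply: pd_kernel_scale (pd_kernel_rank1 _); lra.
pose S n p q : R := \sum_(0 <= k < n) (k`!%:R)^-1 * (D k p q * M p q ^+ k).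
apply: (@pd_kernel_cvg _ _ S) => [n|p q].
  rewrite /S; elim: n => [|n IH].
    rewrite (_ : (fun _ => _) = fun p q => 0 * M p q).
      exact: pd_kernel_scale.
    by apply/funext => p; apply/funext => q; rewrite big_nil mul0r.
  rewrite [X in pd_kernel X](_ :
    _ = fun p q => \sum_(0 <= k < n) (k`!%:R)^-1 * (D k p q * M p q ^+ k)
      + (n`!%:R)^-1 * (D n p q * M p q ^+ n)); last first.
    by apply/funext => p; apply/funext => q; rewrite big_nat_recr.
  apply: pd_kernel_add => //; apply: pd_kernel_scale => //.
  exact: (pd_kernel_mul (Dpd n) (pd_kernel_exp _ Mpd)).
rewrite /S /D; case: ifP => bpq.
  rewrite [X in X @ _ --> _](_ : _ = series (exp_coeff (M p q))).
    exact: is_cvg_series_exp_coeff.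
  by apply/funext => n; apply: eq_bigr => k _; rewrite mul1r /exp_coeff mulrC.
rewrite [X in X @ _ --> _](_ : _ = series (sin_coeff (M p q))).
  rewrite unlock; exact: is_cvg_series_sin_coeff.
by apply/funext => n; apply: eq_bigr => k _; rewrite mulrC.
Qed.

Lemma pd_exp_opp_sin {X : eqType} (g : X -> X -> R) (z x y : X) (t d : R) :
  cond_neg_def g -> exists C : R, pd_kernel (fun p q : option X =>
    match p, q with
    | Some u, Some v => expR (- g u v)
    | Some u, None | None, Some u => expR (- g u z) * sin (t * (g u x - g u y) + d)
    | None, None => C
    end).
Proof.
move=> gcnd.
(* The weights at [x] and [y] sum to zero, so the terms [g u z] cancel in [M (Some u) None] and
   [t * (g u x - g u y)] remains, up to a constant. *)
pose l (p : option X) := if p is Some u then [:: (1, u)] else [:: (- t, x); (t, y)].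
(* This rank one term adjusts that constant to [d]. Its price is an extra 1 in
   [M (Some u) (Some v)], which the factor [E] removes together with [g z z]. *)
pose k (p : option X) := if p is Some u then 1 else d - t * (g y z - g x z).
pose M p q := form (centered g z) (l p) (l q) + k p * k q.
have Mpd : pd_kernel M.
  apply: pd_kernel_add (pd_kernel_rank1 k).
  exact: pd_kernel_pullback (pd_centered _ gcnd).
pose E := expR (g z z - 1).
have E0 : E != 0 by rewrite gt_eqF ?expR_gt0.
(* [f] restores the factors [expR (- g u z)] lost by centering; its value at [None] cancels [E] in
   the mixed entries. *)
pose f (p : option X) := if p is Some u then expR (- g u z) else E^-1.
exists (E * (f None * f None) * expR (M None None)).
have := pd_kernel_mul (pd_kernel_scale (expR_ge0 (g z z - 1)) (pd_kernel_rank1 f))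
  (pd_exp_sin isSome Mpd).
have Mmix u : M (Some u) None = t * (g u x - g u y) + d.
  rewrite /M /= -[[:: (- t, x); _]]cat1s form_catr !form_eval /centered /=; ring.
congr pd_kernel; apply/funext => -[u|]; apply/funext => -[v|] //=.
- rewrite /M /= form_eval -!expRD /centered /=; congr expR; ring.
- by rewrite Mmix -/E; field.
- by rewrite Mpd.1 Mmix -/E; field.
Qed.

Lemma pd_exp_opp {X : eqType} (g : X -> X -> R) :
  cond_neg_def g -> pd_kernel (fun u v => expR (- g u v)).
Proof.
move=> gcnd; split=> [u v|s]; first by rewrite gcnd.1.
(* A base point is needed, and the head of the list supplies it. *)
case: s => [|[a z] s]; first by rewrite /form pairing_nil.
have [C /pd_kernel_pullback H] := pd_exp_opp_sin z z z 0 0 gcnd.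
have [_ /(_ ((a, z) :: s))] := H _ (fun u => [:: (1, Some u)]).
congr (_ <= _); rewrite !form_sum; apply: eq_bigr => p _; apply: eq_bigr => q _.
by rewrite form_eval !mul1r.
Qed.

End NegativeDefiniteKernels.

(** * The real RKHS, described by a supremum over finite combinations *)

Section RealRKHS.
Context {R : realType} {T : Type} (K : T -> T -> R).
Hypothesis Kpd : pd_kernel K.
Implicit Types (F G H : T -> R) (s t : seq (R * T)).

Let Ksym := Kpd.1.

(* [F] belongs to the real RKHS iff these values are bounded, and then their
   supremum is the squared norm of [F]: it is attained at [F] itself, since
   [2 <F, s> - |s|^2 = |F|^2 - |F - s|^2]. *)
Definition rkhs_values F : set R := range (fun s => 2 * pairing F s - form K s s).

Definition real_rkhs F : Prop := has_ubound (rkhs_values F).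

Definition sqnorm F : R := sup (rkhs_values F).

Definition lincomb (a : R) F (b : R) G : T -> R := fun x => a * F x + b * G x.

Lemma rkhs_values_neq0 F : rkhs_values F !=set0.
Proof. by exists (2 * pairing F [::] - form K [::] [::]), [::]. Qed.

Lemma sqnorm_ub F s : real_rkhs F -> 2 * pairing F s - form K s s <= sqnorm F.
Proof. by move=> RF; apply: (ub_le_sup RF); exists s. Qed.

Lemma sqnorm_le F (c : R) : (forall s, 2 * pairing F s - form K s s <= c) ->
  real_rkhs F /\ sqnorm F <= c.
Proof.
move=> H; have ub : ubound (rkhs_values F) c by move=> _ [s _ <-].
by split; [exists c | apply: ge_sup => //; exact: rkhs_values_neq0].
Qed.

Lemma form_nil s : form K [::] s = 0.
Proof. by rewrite /form pairing_nil. Qed.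

Lemma sqnorm_ge0 F : real_rkhs F -> 0 <= sqnorm F.
Proof.
by move=> RF; have := sqnorm_ub [::] RF; rewrite pairing_nil form_nil; lra.
Qed.

Lemma sqr_pairing_le F s : real_rkhs F -> pairing F s ^+ 2 <= sqnorm F * form K s s.
Proof.
move=> RF; apply: discriminant_le => a b.
have [->|a0] := eqVneq a 0.
  by rewrite expr0n /= mulr0 !mul0r !add0r mulr_ge0 ?sqr_ge0 ?Kpd.2.
have := sqnorm_ub (scale_combo (- b / a) s) RF.
rewrite pairing_scale form_scalel form_scaler -subr_ge0.
move=> /(mulr_ge0 (sqr_ge0 a)); congr (_ <= _); by field.
Qed.

Lemma sqr_eval_le F x : real_rkhs F -> F x ^+ 2 <= sqnorm F * K x x.
Proof.
move=> /(sqr_pairing_le [:: (1, x)]).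
by rewrite pairing1 form_eval !mul1r.
Qed.

Lemma real_rkhs_scale (a : R) F : real_rkhs F ->
  real_rkhs (fun x => a * F x) /\ sqnorm (fun x => a * F x) <= a ^+ 2 * sqnorm F.
Proof.
move=> RF; apply: sqnorm_le => s.
have -> : pairing (fun x => a * F x) s = a * pairing F s.
  by rewrite /pairing mulr_sumr; apply: eq_bigr => p _; ring.
have [->|a0] := eqVneq a 0.
  by have := Kpd.2 s; rewrite expr0n /=; lra.
rewrite -subr_ge0; have := sqnorm_ub (scale_combo a^-1 s) RF.
rewrite pairing_scale form_scalel form_scaler -subr_ge0 => /(mulr_ge0 (sqr_ge0 a)).
by congr (_ <= _); field.
Qed.

Lemma sqnorm_scale (a : R) F : real_rkhs F ->
  sqnorm (fun x => a * F x) = a ^+ 2 * sqnorm F.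
Proof.
move=> RF; have [RaF aF] := real_rkhs_scale a RF.
apply/eqP; rewrite eq_le aF /=; have [a0|a0] := eqVneq a 0.
  by have := sqnorm_ge0 RaF; rewrite a0 expr0n mul0r.
have [_] := real_rkhs_scale a^-1 RaF.
rewrite (_ : (fun x => _) = F); last by apply/funext => x; rewrite mulKf.
by rewrite exprVn ler_pdivlMl// exprn_even_gt0.
Qed.

(** Testing [F + G] on [s] and [F - G] on [t] amounts to testing [F] on [(s + t) / 2] and [G] on
    [(s - t) / 2], each counted twice. The supremum is taken over [s], and then over [t]. *)
Lemma parallelogram_le F G : real_rkhs F -> real_rkhs G ->
  [/\ real_rkhs (lincomb 1 F 1 G), real_rkhs (lincomb 1 F (-1) G) &
    sqnorm (lincomb 1 F 1 G) + sqnorm (lincomb 1 F (-1) G) <=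
    2 * sqnorm F + 2 * sqnorm G].
Proof.
move=> RF RG.
have H s t : 2 * pairing (lincomb 1 F 1 G) s - form K s s +
    (2 * pairing (lincomb 1 F (-1) G) t - form K t t) <=
      2 * sqnorm F + 2 * sqnorm G.
  have := sqnorm_ub (scale_combo 2^-1 (s ++ t)) RF.
  have := sqnorm_ub (scale_combo 2^-1 (s ++ scale_combo (-1) t)) RG.
  rewrite !(pairing_scale, pairing_cat, pairing_linear).
  rewrite !(form_scalel, form_scaler, form_catl, form_catr) (form_sym Ksym t s).
  by rewrite !mul1r; lra.
have [RFG _] : real_rkhs (lincomb 1 F 1 G) /\
  sqnorm (lincomb 1 F 1 G) <= 2 * sqnorm F + 2 * sqnorm G.
  by apply: sqnorm_le => s; have := H s [::]; rewrite pairing_nil form_nil; lra.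
have [RFG' le] : real_rkhs (lincomb 1 F (-1) G) /\ sqnorm (lincomb 1 F (-1) G) <=
    2 * sqnorm F + 2 * sqnorm G - sqnorm (lincomb 1 F 1 G).
  apply: sqnorm_le => t; rewrite lerBrDr -lerBrDl.
  by apply: (sqnorm_le _).2 => s; have := H s t; lra.
by split=> //; lra.
Qed.

Lemma real_rkhs_lincomb a F b G : real_rkhs F -> real_rkhs G ->
  real_rkhs (lincomb a F b G).
Proof.
move=> /(real_rkhs_scale a)[RF _] /(real_rkhs_scale b)[RG _].
have [H _ _] := parallelogram_le RF RG; congr real_rkhs: H.
by apply/funext => x; rewrite /lincomb !mul1r.
Qed.

Lemma parallelogram F G : real_rkhs F -> real_rkhs G ->
  sqnorm (lincomb 1 F 1 G) + sqnorm (lincomb 1 F (-1) G) =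
  2 * sqnorm F + 2 * sqnorm G.
Proof.
move=> RF RG; have [RD RB le] := parallelogram_le RF RG.
(* The reverse inequality is the same one applied to [F + G] and [F - G], whose sum and difference
   are [2 F] and [2 G]. *)
have [_ _] := parallelogram_le RD RB.
have -> : lincomb 1 (lincomb 1 F 1 G) 1 (lincomb 1 F (-1) G) = (fun x => 2 * F x).
  by apply/funext => x; rewrite /lincomb; ring.
have -> : lincomb 1 (lincomb 1 F 1 G) (-1) (lincomb 1 F (-1) G) =
  (fun x => 2 * G x).
  by apply/funext => x; rewrite /lincomb; ring.
by rewrite !sqnorm_scale//; lra.
Qed.

Definition dot F G : R :=
  (sqnorm (lincomb 1 F 1 G) - sqnorm (lincomb 1 F (-1) G)) / 4.

Lemma dot_sym F G : real_rkhs F -> real_rkhs G -> dot F G = dot G F.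
Proof.
move=> RF RG; rewrite /dot.
have -> : lincomb 1 G 1 F = lincomb 1 F 1 G.
  by apply/funext => x; rewrite /lincomb; ring.
have -> // : sqnorm (lincomb 1 G (-1) F) = sqnorm (lincomb 1 F (-1) G).
have := sqnorm_scale (-1) (real_rkhs_lincomb 1 (-1) RF RG).
rewrite sqrrN expr1n mul1r => <-; congr sqnorm.
by apply/funext => x; rewrite /lincomb; ring.
Qed.

Lemma dot_self F : real_rkhs F -> dot F F = sqnorm F.
Proof.
move=> RF; rewrite /dot.
have -> : lincomb 1 F 1 F = (fun x => 2 * F x).
  by apply/funext => x; rewrite /lincomb; ring.
have -> : lincomb 1 F (-1) F = (fun x => 0 * F x).
  by apply/funext => x; rewrite /lincomb; ring.
by rewrite !sqnorm_scale//; lra.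
Qed.

Lemma dot_le F G : real_rkhs F -> real_rkhs G ->
  `|dot F G| <= (sqnorm F + sqnorm G) / 2.
Proof.
move=> RF RG; have := parallelogram RF RG.
have := sqnorm_ge0 (real_rkhs_lincomb 1 1 RF RG).
have := sqnorm_ge0 (real_rkhs_lincomb 1 (-1) RF RG).
by rewrite /dot ler_norml; lra.
Qed.

(* The Jordan-von Neumann argument. *)
Lemma dot_add F G H : real_rkhs F -> real_rkhs G -> real_rkhs H ->
  dot (lincomb 1 F 1 G) H = dot F H + dot G H.
Proof.
have double F' G' H' : real_rkhs F' -> real_rkhs G' -> real_rkhs H' ->
    dot F' H' + dot G' H' = dot (lincomb 1 F' 1 G') (fun x => 2 * H' x) / 2.
  move=> RF RG RH.
  have := parallelogram (real_rkhs_lincomb 1 1 RF RH) (real_rkhs_lincomb 1 1 RG RH).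
  have := parallelogram (real_rkhs_lincomb 1 (-1) RF RH) (real_rkhs_lincomb 1 (-1)
    RG RH).
  rewrite /dot.
  set B := lincomb 1 (lincomb 1 F' (-1) H') _ _.
  set C := lincomb 1 (lincomb 1 F' (-1) H') _ _.
  set A := lincomb 1 (lincomb 1 F' 1 H') _ _.
  set D := lincomb 1 (lincomb 1 F' 1 H') _ _.
  have -> : D = C by apply/funext => x; rewrite /D /C /lincomb; ring.
  have -> : A = lincomb 1 (lincomb 1 F' 1 G') 1 (fun x => 2 * H' x).
    by apply/funext => x; rewrite /A /lincomb; ring.
  have -> : B = lincomb 1 (lincomb 1 F' 1 G') (-1) (fun x => 2 * H' x).
    by apply/funext => x; rewrite /B /lincomb; ring.
  by lra.
move=> RF RG RH; rewrite double//.
have RFG := real_rkhs_lincomb 1 1 RF RG.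
pose Z x := 0 * F x.
have RZ : real_rkhs Z := (real_rkhs_scale 0 RF).1.
have dotZ : dot Z H = 0.
  rewrite /dot (_ : lincomb 1 Z 1 H = H); last first.
    by apply/funext => x; rewrite /lincomb /Z; ring.
  rewrite (_ : lincomb 1 Z (-1) H = fun x => -1 * H x); last first.
    by apply/funext => x; rewrite /lincomb /Z; ring.
  by rewrite sqnorm_scale// sqrrN expr1n mul1r subrr mul0r.
(* Taking zero as the second function in [double] halves the inner product with [2 H]. *)
have := double _ _ _ RFG RZ RH; rewrite dotZ addr0 => ->.
congr (dot _ _ / 2); by apply/funext => x; rewrite /lincomb /Z; ring.
Qed.

(** Cauchy's functional equation. The defect [h] is additive and vanishes on the integers, so
    [n * h a] equals [h] at the fractional part of [n * a] and stays bounded in [n]. *)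
Lemma additive_bounded_linear (f : R -> R) (C : R) :
  (forall a b, f (a + b) = f a + f b) -> (forall a, `|a| <= 1 -> `|f a| <= C) ->
  forall a, f a = a * f 1.
Proof.
move=> fD fC a; pose h a := f a - a * f 1.
have hD x y : h (x + y) = h x + h y by rewrite /h fD; ring.
have h0 : h 0 = 0 by have := hD 0 0; rewrite addr0; lra.
have hN x : h (- x) = - h x by have := hD x (- x); rewrite subrr h0; lra.
have hnat n x : h (n%:R * x) = n%:R * h x.
  elim: n => [|n IH]; first by rewrite !mul0r.
  by rewrite -natr1 !mulrDl !mul1r hD IH.
have h1 : h 1 = 0 by rewrite /h mul1r subrr.
have hint (m : int) : h m%:~R = 0.
  case: m => n; first by have := hnat n 1; rewrite !mulr1 h1 mulr0.
  rewrite NegzE mulrNz hN; have := hnat n.+1 1; rewrite !mulr1 h1 mulr0 => ->.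
  by rewrite oppr0.
have hC x : `|x| <= 1 -> `|h x| <= C + `|f 1|.
  move=> x1; apply: (le_trans (ler_normB _ _)); rewrite lerD ?fC//.
  by rewrite normrM ler_piMl.
have hb n : n%:R * `|h a| <= C + `|f 1|.
  pose m : int := Num.floor (n%:R * a).
  have : `|h (n%:R * a - m%:~R)| <= C + `|f 1|.
    apply: hC; have := Num.Theory.floor_le_tmp (n%:R * a);
      have := Num.Theory.floorD1_gt (n%:R * a).
    by rewrite -/m ler_norml intrD; lra.
  by rewrite hD hN hint subr0 hnat normrM normr_nat.
suff : `|h a| <= 0 by rewrite normr_le0 subr_eq0 => /eqP.
rewrite leNgt; apply/negP => ha.
have [n] : exists n : nat, C + `|f 1| < n%:R * `|h a|.
  exists (Num.truncn ((C + `|f 1|) / `|h a|)).+1.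
  by rewrite -ltr_pdivrMr// Num.Theory.truncnS_gt.
by rewrite ltNge hb.
Qed.

Lemma dot_scale (a : R) F G : real_rkhs F -> real_rkhs G ->
  dot (fun x => a * F x) G = a * dot F G.
Proof.
move=> RF RG.
rewrite (@additive_bounded_linear (fun a => dot (fun x => a * F x) G) ((sqnorm F +
  sqnorm G) / 2)).
- by congr (_ * dot _ _); apply/funext => x; rewrite mul1r.
- move=> b c; rewrite -dot_add//; last 2 first.
  + exact: (real_rkhs_scale b RF).1.
  + exact: (real_rkhs_scale c RF).1.
  by congr (dot _ _); apply/funext => x; rewrite /lincomb; ring.
move=> b b1; apply: (le_trans (dot_le (real_rkhs_scale _ RF).1 RG)).
rewrite ler_pM2r// lerD2r sqnorm_scale// ler_piMl ?sqnorm_ge0//.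
by rewrite -real_normK ?num_real// expr_le1.
Qed.

Lemma dot_lincomb a F b G H : real_rkhs F -> real_rkhs G -> real_rkhs H ->
  dot (lincomb a F b G) H = a * dot F H + b * dot G H.
Proof.
move=> RF RG RH; have [RaF _] := real_rkhs_scale a RF.
have [RbG _] := real_rkhs_scale b RG.
rewrite -dot_scale// -dot_scale// -dot_add//; congr (dot _ _).
by apply/funext => x; rewrite /lincomb !mul1r.
Qed.

(** Completing the square: a test of [F - s] on [t] is a test of [F] on [s ++ t], up to terms
    independent of [t]. *)
Lemma real_rkhs_sub_combo F s : real_rkhs F ->
  real_rkhs (lincomb 1 F (-1) (combo K s)) /\
  sqnorm (lincomb 1 F (-1) (combo K s)) <= sqnorm F + form K s s - 2 * pairing F s.
Proof.
move=> RF; apply: sqnorm_le => t; have := sqnorm_ub (s ++ t) RF.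
rewrite pairing_cat !(form_catl, form_catr) pairing_linear -/(form K t s).
by rewrite (form_sym Ksym t s); lra.
Qed.

Lemma real_rkhs0 : real_rkhs (fun=> 0) /\ sqnorm (fun=> 0) = 0.
Proof.
have [R0 le0] : real_rkhs (fun=> 0) /\ sqnorm (fun=> 0) <= 0.
  apply: sqnorm_le => s; have := Kpd.2 s.
  by rewrite /pairing big1 ?mulr0 => [|p _]; [lra|rewrite mulr0].
by split=> //; apply/eqP; rewrite eq_le le0 sqnorm_ge0.
Qed.

Lemma real_rkhs_kernel y : real_rkhs (K^~ y) /\ sqnorm (K^~ y) = K y y.
Proof.
have [R0 N0] := real_rkhs0; have [] := real_rkhs_sub_combo [:: (-1, y)] R0.
have -> : lincomb 1 (fun=> 0) (-1) (combo K [:: (-1, y)]) = K^~ y.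
  by apply/funext => x; rewrite /lincomb combo1; ring.
rewrite N0 form_eval pairing1 mulr0 => RK le; split=> //.
have := sqnorm_ub [:: (1, y)] RK; rewrite pairing1 form_eval => ge.
by apply/eqP; rewrite eq_le; apply/andP; split; lra.
Qed.

(** The upper bounds for the squared norms of [F + K^~ y] and [F - K^~ y] add up to exactly the
    parallelogram value, so both are equalities. *)
Lemma dot_kernel F y : real_rkhs F -> dot F (K^~ y) = F y.
Proof.
move=> RF; have [RK NK] := real_rkhs_kernel y.
have [_] := real_rkhs_sub_combo [:: (-1, y)] RF.
have -> : lincomb 1 F (-1) (combo K [:: (-1, y)]) = lincomb 1 F 1 (K^~ y).
  by apply/funext => x; rewrite /lincomb combo1; ring.
have [_] := real_rkhs_sub_combo [:: (1, y)] RF.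
have -> : lincomb 1 F (-1) (combo K [:: (1, y)]) = lincomb 1 F (-1) (K^~ y).
  by apply/funext => x; rewrite /lincomb combo1; ring.
rewrite !form_eval !pairing1; have := parallelogram RF RK; rewrite NK /dot.
by move=> H1 H2 H3; apply/eqP; rewrite eq_le; apply/andP; split; lra.
Qed.

(* By [2 <F, s> - |s|^2 = |F|^2 - |F - s|^2], an almost maximal
   [s] is close to [F]. *)
Lemma combo_dense F (e : R) : real_rkhs F -> 0 < e ->
  exists s, real_rkhs (lincomb 1 F (-1) (combo K s)) /\
            sqnorm (lincomb 1 F (-1) (combo K s)) < e.
Proof.
move=> RF e0; have [|_ [s _ <-] lt] := @sup_adherent _ (rkhs_values F) e e0.
  by split=> //; exact: rkhs_values_neq0.
exists s; have [RFs le] := real_rkhs_sub_combo s RF; split=> //.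
by apply: le_lt_trans le _; rewrite -/(sqnorm F) in lt; lra.
Qed.

Lemma real_rkhs_complete (u : nat -> T -> R) : (forall n, real_rkhs (u n)) ->
  (forall e : R, 0 < e -> exists N : nat, forall m n, (N <= m)%N -> (N <= n)%N ->
     sqnorm (lincomb 1 (u m) (-1) (u n)) < e) ->
  exists2 F, real_rkhs F & forall e : R, 0 < e ->
    exists N : nat, forall n, (N <= n)%N -> sqnorm (lincomb 1 (u n) (-1) F) <= e.
Proof.
move=> Ru uC.
have ucvg x : cvg ((fun n => u n x) @ \oo).
  apply/cauchy_cvgP/cauchy_exP => e e0.
  have K1 : 0 < K x x + 1 by rewrite ltr_wpDl ?pd_diag_ge0.
  have [N HN] := uC (e ^+ 2 / (K x x + 1)) (divr_gt0 (exprn_gt0 _ e0) K1).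
  exists (u N x), N => // n /= Nn.
  have := sqr_eval_le x (real_rkhs_lincomb 1 (-1) (Ru N) (Ru n)).
  rewrite /ball /= /lincomb mul1r mulN1r => le.
  rewrite -(ltr_pXn2r (n := 2)) ?nnegrE ?normr_ge0 ?(ltW e0)//.
  rewrite real_normK ?num_real//; apply: (le_lt_trans le).
  have := HN N n (leqnn N) Nn; rewrite ltr_pdivlMr//; apply: le_lt_trans.
  by rewrite ler_wpM2l ?lerDl// sqnorm_ge0//; exact: real_rkhs_lincomb.
pose F x := lim ((fun n => u n x) @ \oo).
have FE x : (fun n => u n x) @ \oo --> F x by exact: ucvg.
(* Each test against [s] involves finitely many points, so pointwise convergence carries it to the
   limit: the norm is lower semicontinuous. *)
have H (e : R) : 0 < e -> exists N : nat, forall n, (N <= n)%N ->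
    real_rkhs (lincomb 1 (u n) (-1) F) /\ sqnorm (lincomb 1 (u n) (-1) F) <= e.
  move=> e0; have [N HN] := uC e e0; exists N => n Nn.
  apply: sqnorm_le => s; rewrite pairing_linear.
  pose v m := 2 * (1 * pairing (u n) s + -1 * pairing (u m) s) - form K s s.
  apply: (@cvgr_to_le _ \oo _ _ v).
    apply: cvgB; last exact: cvg_cst.
    apply: cvgMl_tmp; apply: cvgD; first exact: cvg_cst.
    by apply: cvgMl_tmp; apply: cvg_seq_sum => p; exact: cvgMl_tmp.
  exists N => // m /= Nm; rewrite /v -pairing_linear.
  apply: (le_trans (sqnorm_ub _ (real_rkhs_lincomb 1 (-1) (Ru n) (Ru m)))).
  exact/ltW/HN.
exists F.
  have [N /(_ N (leqnn N))[RB _]] := H 1 ltr01.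
  have := real_rkhs_lincomb 1 (-1) (Ru N) RB; congr real_rkhs.
  by apply/funext => x; rewrite /lincomb; ring.
by move=> e /H[N HN]; exists N => n /HN[].
Qed.

End RealRKHS.

(** * Complexification, and existence of the RKHS of a real kernel *)

Section ComplexRKHS.
Context {R : realType} {T : Type} (K : T -> T -> R).
Hypothesis Kpd : pd_kernel K.

Definition re_fun (F : T -> R[i]) : T -> R := fun x => complex.Re (F x).

Definition im_fun (F : T -> R[i]) : T -> R := fun x => complex.Im (F x).

Definition complex_rkhs : set (T -> R[i]) :=
  [set F | real_rkhs K (re_fun F) /\ real_rkhs K (im_fun F)].

Definition complex_ip (F G : T -> R[i]) : R[i] :=
  Complex (dot K (re_fun F) (re_fun G) + dot K (im_fun F) (im_fun G))
          (dot K (im_fun F) (re_fun G) - dot K (re_fun F) (im_fun G)).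

Lemma re_fun_linear (a : R[i]) (F G : T -> R[i]) : re_fun (a *: F + G) =
  lincomb 1 (lincomb (complex.Re a) (re_fun F) (- complex.Im a) (im_fun F)) 1
    (re_fun G).
Proof.
apply/funext => x; rewrite /re_fun /im_fun /lincomb.
rewrite -[(a *: F + G) x]/(a * F x + G x).
by case: a (F x) (G x) => [a b] [c d] [e f] /=; ring.
Qed.

Lemma im_fun_linear (a : R[i]) (F G : T -> R[i]) : im_fun (a *: F + G) =
  lincomb 1 (lincomb (complex.Re a) (im_fun F) (complex.Im a) (re_fun F)) 1 (im_fun
    G).
Proof.
apply/funext => x; rewrite /re_fun /im_fun /lincomb.
rewrite -[(a *: F + G) x]/(a * F x + G x).
by case: a (F x) (G x) => [a b] [c d] [e f] /=; ring.
Qed.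

Lemma re_funB (F G : T -> R[i]) :
  re_fun (F - G) = lincomb 1 (re_fun F) (-1) (re_fun G).
Proof.
apply/funext => x; rewrite /re_fun /lincomb -[(F - G) x]/(F x - G x).
by case: (F x) (G x) => [a b] [c d] /=; ring.
Qed.

Lemma im_funB (F G : T -> R[i]) :
  im_fun (F - G) = lincomb 1 (im_fun F) (-1) (im_fun G).
Proof.
apply/funext => x; rewrite /im_fun /lincomb -[(F - G) x]/(F x - G x).
by case: (F x) (G x) => [a b] [c d] /=; ring.
Qed.

Lemma complex_rkhsB F G : complex_rkhs F -> complex_rkhs G -> complex_rkhs (F - G).
Proof.
move=> [rF iF] [rG iG]; split; rewrite ?re_funB ?im_funB; exact: real_rkhs_lincomb.
Qed.

Lemma complex_ip_self F : complex_rkhs F ->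
  complex_ip F F = (sqnorm K (re_fun F) + sqnorm K (im_fun F))%:C%C.
Proof.
move=> [rF iF]; rewrite /complex_ip !dot_self// (dot_sym Kpd iF rF) subrr//.
Qed.

Lemma complex_ip_norm F : complex_rkhs F ->
  ip_norm complex_ip F = Num.sqrt (sqnorm K (re_fun F) + sqnorm K (im_fun F)).
Proof. by move=> HF; rewrite /ip_norm complex_ip_self. Qed.

Lemma complex_combo_eval (s t : seq (R * T)) x :
  (\sum_(p <- [seq (p.1%:C%C, p.2) | p <- s] ++ [seq (Complex 0 p.1, p.2) | p <- t])
     p.1 *: (fun y => (K y p.2)%:C%C)) x = Complex (combo K s x) (combo K t x).
Proof.
rewrite fct_sumE big_cat !big_map /combo /=.
have -> : \sum_(p <- s) ((p.1%:C)%C *: (fun y => (K y p.2)%:C%C)) x =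
    Complex (\sum_(p <- s) p.1 * K x p.2) 0.
  elim: s => [|p s IH]; first by rewrite !big_nil.
  rewrite !big_cons IH; congr Complex => /=; ring.
have -> : \sum_(p <- t) ((Complex 0 p.1) *: (fun y => (K y p.2)%:C%C)) x =
    Complex 0 (\sum_(p <- t) p.1 * K x p.2).
  elim: t => [|p t IH]; first by rewrite !big_nil.
  rewrite !big_cons IH; congr Complex => /=; ring.
by congr Complex => /=; ring.
Qed.

Lemma complex_rkhs_is_rkhs :
  is_rkhs (fun x y => (K x y)%:C%C) complex_rkhs complex_ip.
Proof.
have [R0 N0] := real_rkhs0 Kpd.
have rek y : re_fun (fun x => (K x y)%:C%C) = K^~ y by [].
have imk y : im_fun (fun x => (K x y)%:C%C) = fun=> 0 by [].
split.
- by split.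
- move=> a F G [rF iF] [rG iG]; split; rewrite ?re_fun_linear ?im_fun_linear.
    by apply: real_rkhs_lincomb => //; exact: real_rkhs_lincomb.
  by apply: real_rkhs_lincomb => //; exact: real_rkhs_lincomb.
- move=> a F G E [rF iF] [rG iG] [rE iE].
  rewrite /complex_ip re_fun_linear im_fun_linear.
  have rl := real_rkhs_lincomb Kpd (complex.Re a) (- complex.Im a) rF iF.
  have il := real_rkhs_lincomb Kpd (complex.Re a) (complex.Im a) iF rF.
  rewrite !(dot_lincomb Kpd)//.
  by case: a {rl il} => a b /=; congr Complex => /=; ring.
- move=> F G [rF iF] [rG iG]; rewrite /complex_ip.
  rewrite (dot_sym Kpd rG rF) (dot_sym Kpd iG iF) (dot_sym Kpd iG rF) (dot_sym Kpd
    rG iF).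
  by congr Complex => /=; rewrite opprB.
- move=> F HF; rewrite complex_ip_self// lecR.
  by case: HF => rF iF; rewrite addr_ge0 ?sqnorm_ge0.
- move=> F HF; rewrite complex_ip_self// => -[H]; case: HF => rF iF.
  have r0 := sqnorm_ge0 rF; have i0 := sqnorm_ge0 iF.
  have rz : sqnorm K (re_fun F) = 0 by lra.
  have iz : sqnorm K (im_fun F) = 0 by lra.
  apply/funext => x; have := sqr_eval_le Kpd x rF; have := sqr_eval_le Kpd x iF.
  rewrite rz iz !mul0r /re_fun /im_fun; case: (F x) => a b /=.
  rewrite !le_eqVlt !ltNge !sqr_ge0 !orbF !sqrf_eq0 => /eqP -> /eqP ->.
  by [].
- move=> u Hu uC.
  have Cauchy (e : R) : 0 < e -> exists N : nat, forall m n, (N <= m)%N ->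
    (N <= n)%N ->
      sqnorm K (lincomb 1 (re_fun (u m)) (-1) (re_fun (u n))) < e /\
      sqnorm K (lincomb 1 (im_fun (u m)) (-1) (im_fun (u n))) < e.
    move=> e0; have [|N HN] := uC (Num.sqrt e); first by rewrite sqrtr_gt0.
    exists N => m n Nm Nn; have := HN m n Nm Nn.
    have [rB iB] := complex_rkhsB (Hu m) (Hu n).
    rewrite complex_ip_norm// ltr_sqrt// re_funB im_funB.
    rewrite re_funB in rB; rewrite im_funB in iB.
    by have := sqnorm_ge0 rB; have := sqnorm_ge0 iB; split; lra.
  have [|A RA HA] := real_rkhs_complete Kpd (fun n => (Hu n).1).
    by move=> e /Cauchy[N HN]; exists N => m n Nm Nn; have [] := HN m n Nm Nn.
  have [|B RB HB] := real_rkhs_complete Kpd (fun n => (Hu n).2).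
    by move=> e /Cauchy[N HN]; exists N => m n Nm Nn; have [] := HN m n Nm Nn.
  pose F x : R[i] := Complex (A x) (B x).
  have HF : complex_rkhs F by split.
  exists F => //; apply/cvgrPdist_le => e e0.
  have e2 : 0 < e ^+ 2 / 2 by rewrite divr_gt0 ?exprn_gt0.
  have [N1 H1] := HA _ e2; have [N2 H2] := HB _ e2.
  exists (maxn N1 N2) => // n /=; rewrite geq_max => /andP[N1n N2n].
  rewrite sub0r normrN complex_ip_norm; last exact: complex_rkhsB.
  rewrite ger0_norm ?sqrtr_ge0// re_funB im_funB.
  rewrite -(ger0_norm (ltW e0)) -sqrtr_sqr ler_wsqrtr//.
  by have := H1 n N1n; have := H2 n N2n; lra.
- by move=> y; split; [exact: (real_rkhs_kernel Kpd y).1 | exact: R0].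
- move=> F y [rF iF]; rewrite /complex_ip rek imk.
  have z G : real_rkhs K G -> dot K G (fun=> 0) = 0.
    move=> RG; rewrite dot_sym//.
    rewrite (_ : (fun=> 0) = fun x => 0 * G x) ?dot_scale ?mul0r//.
    by apply/funext => x; rewrite mul0r.
  rewrite !dot_kernel// !z// addr0 subr0 /re_fun /im_fun.
  by case: (F y).
- move=> F e [rF iF] e0.
  have e2 : 0 < e ^+ 2 / 2 by rewrite divr_gt0 ?exprn_gt0.
  have [s [Rs Ns]] := combo_dense Kpd rF e2.
  have [t [Rt Nt]] := combo_dense Kpd iF e2.
  (* Approximants of the real and imaginary parts, joined with real and purely imaginary
     coefficients. *)
  pose w := [seq (p.1%:C%C, p.2) | p <- s] ++ [seq (Complex 0 p.1, p.2) | p <- t].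
  exists (size w), (fun i => (tnth (in_tuple w) i).1), (fun i => (tnth (in_tuple w)
    i).2).
  rewrite -(big_tnth _ _ w xpredT (fun p :
    R[i] * T => p.1 *: (fun y => (K y p.2)%:C%C))).
  set G := \sum_(p <- w) _.
  have GE x : G x = Complex (combo K s x) (combo K t x) := complex_combo_eval s t x.
  have rG : re_fun (F - G) = lincomb 1 (re_fun F) (-1) (combo K s).
    by rewrite re_funB; congr lincomb; apply/funext => x; rewrite /re_fun GE.
  have iG : im_fun (F - G) = lincomb 1 (im_fun F) (-1) (combo K t).
    by rewrite im_funB; congr lincomb; apply/funext => x; rewrite /im_fun GE.
  rewrite complex_ip_norm; last by split; rewrite ?rG ?iG.
  rewrite rG iG -(ger0_norm (ltW e0)) -sqrtr_sqr ltr_sqrt ?exprn_gt0//; lra.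
Qed.

End ComplexRKHS.

(** * Multipliers and a weighted Stone-Weierstrass theorem *)

Section WeightedStoneWeierstrass.
Context {R : realType} {X : topologicalType}.
Implicit Types (f g h m : X -> R).

(** If [P A] failed, the sets [U] with [P (A \ U)] would form a proper filter; at a cluster point of
    it in [A], the local hypothesis gives a contradiction. *)
Lemma compact_induction (A : set X) (P : set X -> Prop) : compact A ->
  P set0 -> (forall B C, P B -> P C -> P (B `|` C)) ->
  (forall B C, B `<=` C -> P C -> P B) ->
  (forall x, A x -> exists2 U, nbhs x U & P U) -> P A.
Proof.
move=> cA P0 PU Psub Ploc; apply: contrapT => nPA.
pose F : set_system X := [set U | P (A `\` U)].
have FF : ProperFilter F.
  split; first by rewrite /F /= setD0.
  split; rewrite /F /=.
  - by rewrite setDT.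
  - by move=> U V PA PB /=; rewrite setDE setCI setIUr; exact: PU.
  - by move=> U V UV; apply: Psub; exact: setDS.
have [|x [Ax clx]] := cA F FF; first by rewrite /F /= setDv.
have [U xU PU'] := Ploc x Ax.
have [|y []] := clx (~` U) U _ xU; last by [].
by apply: Psub PU'; rewrite setDE setCK => z [].
Qed.

Lemma compact_bounded_fun (A : set X) f : compact A -> continuous f ->
  exists2 C, 0 < C & forall x, A x -> `|f x| <= C.
Proof.
move=> cA fc; apply: (compact_induction (P :=
  fun B => exists2 C, 0 < C & forall x, B x -> `|f x| <= C)) cA _ _ _ _.
- by exists 1.
- move=> B D [b b0 Hb] [d d0 Hd]; exists (b + d); first exact: addr_gt0.
  by move=> x [/Hb|/Hd]; lra.
- by move=> B D BD [d d0 Hd]; exists d => // x /BD/Hd.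
move=> x _; exists [set y | `|f x - f y| < 1].
  by move/cvgrPdist_lt: (fc x); apply; exact: ltr01.
exists (`|f x| + 1); first by rewrite ltr_wpDl.
move=> y /= lt; have -> : f y = f x - (f x - f y) by ring.
by apply: (le_trans (ler_normB _ _)); rewrite lerD2l ltW.
Qed.

Variable M : set (X -> R).
Hypothesis M_linear : forall a f b g, M f -> M g -> M (lincomb a f b g).
Hypothesis M_closed : forall f,
  (forall e : R, 0 < e -> exists2 g, M g & forall x, `|f x - g x| <= e) -> M f.
Hypothesis M_bounded : forall f, M f -> exists2 C, 0 < C & forall x, `|f x| <= C.

(** Products are available here and not in [M], which is assumed to be only a uniformly closed space
    of bounded functions. *)
Definition multiplier f : Prop :=
  [/\ continuous f, exists2 C, 0 < C & forall x, `|f x| <= C &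
      forall m, M m -> M (fun x => f x * m x)].

Lemma multiplier_closed f : continuous f ->
  (forall e : R, 0 < e -> exists2 g, multiplier g & forall x, `|f x - g x| <= e) ->
  multiplier f.
Proof.
move=> fc H; split=> //.
  have [g [_ [C C0 gC] _] fg] := H 1 ltr01; exists (C + 1); first exact: addr_gt0.
  move=> x; have -> : f x = g x + (f x - g x) by ring.
  by apply: (le_trans (ler_normD _ _)); rewrite lerD.
move=> m Mm; apply: M_closed => e e0; have [C C0 mC] := M_bounded Mm.
have [g [_ _ gM] fg] := H _ (divr_gt0 e0 C0).
exists (fun x => g x * m x); first exact: gM.
move=> x; rewrite -mulrBl normrM -[leRHS](divfK (lt0r_neq0 C0)).
by rewrite ler_pM.
Qed.

Lemma multiplier_cst (a : R) : multiplier (fun=> a).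
Proof.
split; first by move=> x; exact: cvg_cst.
  by exists (`|a| + 1) => [|x]; [rewrite ltr_wpDl | rewrite lerDl].
move=> m Mm; have := M_linear a 0 Mm Mm; congr M.
by apply/funext => x; rewrite /lincomb mul0r addr0.
Qed.

Lemma multiplier_mul f g : multiplier f -> multiplier g ->
  multiplier (fun x => f x * g x).
Proof.
move=> [fc [C C0 fC] fM] [gc [D D0 gD] gM]; split.
- by move=> x; apply: cvgM; [exact: fc | exact: gc].
- by exists (C * D) => [|x]; [exact: mulr_gt0 | rewrite normrM ler_pM].
move=> m /gM/fM; congr M; by apply/funext => x; rewrite mulrA.
Qed.

Lemma multiplier_lincomb a f b g :
  multiplier f -> multiplier g -> multiplier (lincomb a f b g).
Proof.
move=> [fc [C C0 fC] fM] [gc [D D0 gD] gM]; split.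
- by move=> x; apply: cvgD; apply: cvgMl_tmp; [exact: fc | exact: gc].
- exists (`|a| * C + `|b| * D + 1) => [|x].
    by rewrite ltr_wpDl// addr_ge0// mulr_ge0// ltW.
  apply: (le_trans (ler_normD _ _)); rewrite !normrM ler_wpDr// lerD// ler_wpM2l//.
move=> m Mm; have := M_linear a b (fM _ Mm) (gM _ Mm); congr M.
by apply/funext => x; rewrite /lincomb; ring.
Qed.

(* The Newton-like iteration [p -> p + (t^2 - p^2) / 2] converges to [|t|]
   uniformly for [|t| <= 1]. *)
Lemma multiplier_abs f : multiplier f -> multiplier (fun x => `|f x|).
Proof.
move=> fA; have [fc [C C0 fC] _] := fA.
pose s x := f x / C.
have s1 x : `|s x| <= 1.
  by rewrite normrM normfV (gtr0_norm C0) ler_pdivrMr// mul1r.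
have sA : multiplier s.
  have := multiplier_mul (multiplier_cst C^-1) fA; congr multiplier.
  by apply/funext => x; rewrite mulrC.
pose p := fix p n : X -> R := if n is n'.+1 then
  lincomb 1 (p n') (1 / 2) (lincomb 1 (fun x => s x * s x) (-1) (fun x => p n' x *
    p n' x))
  else fun=> 0.
have pA n : multiplier (p n).
  elim: n => [|n IH] /=; first exact: multiplier_cst.
  by do 2?[apply: multiplier_lincomb => //]; exact: multiplier_mul.
(* The explicit rate makes convergence uniform in [x]. The error obeys [e' <= e * (1 - e / 2)], a
   function increasing on [0, 1], and the bound [2 / (n + 2)] is preserved by it. *)
have pB n x : 0 <= p n x <= `|s x| /\ (`|s x| - p n x) * (n%:R + 2) <= 2.
  elim: n => [|n [/andP[IH0 IH1] IH2]] /=; first by have := s1 x;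
    rewrite lexx normr_ge0; split=> //; lra.
  have sE : s x * s x = `|s x| * `|s x| by rewrite -!expr2 real_normK ?num_real.
  rewrite /lincomb sE; have := s1 x; set t := `|s x| in IH1 IH2 *;
    set q := p n x in IH0 IH1 IH2 *.
  move=> t1; have n0 : (0 : R) <= n%:R by [].
  have dq : t - (1 * q + 1 / 2 * (1 * (t * t) + -1 * (q * q))) =
    (t - q) * (1 - (t + q) / 2) by field.
  split.
    apply/andP; split; last by rewrite -subr_ge0 dq mulr_ge0 ?subr_ge0//; lra.
    have : q * q <= t * t by rewrite ler_pM.
    lra.
  rewrite dq -(natr1 n); set k : R := n%:R in n0 IH2 *.
  set e := t - q in IH2 *.
  have e0 : 0 <= e by rewrite /e; lra.
  have le1 : e * (1 - (t + q) / 2) * (k + 1 + 2) <= e * (1 - e / 2) * (k + 3).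
    rewrite (_ : k + 1 + 2 = k + 3); last by ring.
    by rewrite ler_wpM2r ?ler_wpM2l//; rewrite /e; lra.
  apply: (le_trans le1).
  have k2 : 0 < k + 2 by lra.
  pose a := 2 / (k + 2); have aE : a * (k + 2) = 2 by rewrite divfK ?gt_eqF.
  have ea : e <= a by rewrite ler_pdivlMr.
  have a1 : a <= 1 by rewrite ler_pdivrMr//; lra.
  (* The monotonicity used: this product is the difference of the values of [v * (1 - v / 2)] at [a]
     and at [e], times [k + 3]. *)
  have : 0 <= (a - e) * (1 - (a + e) / 2) * (k + 3).
    by rewrite !mulr_ge0//; lra.
  have : a * (1 - a / 2) * (k + 3) = 2 - a ^+ 2 / 2.
    rewrite (_ : k + 3 = (k + 2) + 1); last by ring.
    rewrite (_ : _ * _ * _ = a * (k + 2) * (1 - a / 2) + a - a ^+ 2 / 2);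
      last by ring.
    by rewrite aE; field.
  have := sqr_ge0 a; lra.
apply: multiplier_closed => [x|e e0]; first by apply: cvg_norm; exact: fc.
have [n Hn] : exists n : nat, 2 * C <= e * (n%:R + 2).
  exists (Num.truncn (2 * C / e)).+1.
  have := Num.Theory.truncnS_gt (2 * C / e); rewrite ltr_pdivrMr// => lt.
  by have := e0; lra.
exists (fun x => C * p n x).
  exact: multiplier_mul (multiplier_cst C) (pA n).
move=> x; have [/andP[_ le1] le2] := pB n x.
have -> : `|f x| = C * `|s x|.
  by rewrite /s normrM normfV (gtr0_norm C0) mulrCA divff ?mulr1// gt_eqF.
rewrite -mulrBr ger0_norm; last by rewrite mulr_ge0 ?subr_ge0// ltW.
have n2 : (0 : R) < n%:R + 2 by rewrite ltr_wpDl.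
rewrite -(ler_pM2r n2); apply: le_trans Hn; rewrite -mulrA mulrC.
by rewrite ler_pM2r.
Qed.

Lemma multiplier_max f g : multiplier f -> multiplier g ->
  multiplier (fun x => Num.max (f x) (g x)).
Proof.
move=> fA gA; have := multiplier_abs (multiplier_lincomb 1 (-1) fA gA).
move=> /(multiplier_lincomb (1 / 2) (1 / 2) (multiplier_lincomb 1 1 fA gA)).
congr multiplier; apply/funext => x; rewrite /lincomb mulN1r !mul1r maxr_absE.
by field.
Qed.

Lemma multiplier_min f g : multiplier f -> multiplier g ->
  multiplier (fun x => Num.min (f x) (g x)).
Proof.
move=> fA gA; have := multiplier_abs (multiplier_lincomb 1 (-1) fA gA).
move=> /(multiplier_lincomb (1 / 2) (- (1 / 2)) (multiplier_lincomb 1 1 fA gA)).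
congr multiplier; apply/funext => x; rewrite /lincomb mulN1r !mul1r minr_absE.
by field.
Qed.

Hypothesis multiplier_separates : forall x y : X, x <> y ->
  exists2 f, multiplier f & f x <> f y.

Lemma multiplier_interpolate h x y :
  exists f, [/\ multiplier f, f x = h x & f y = h y].
Proof.
have [->|xy] := pselect (x = y).
  by exists (fun=> h y); split=> //; exact: multiplier_cst.
have [s sA sxy] := multiplier_separates xy.
have sn0 : s y - s x != 0 by rewrite subr_eq0 eq_sym; apply/eqP.
exists (lincomb ((h y - h x) / (s y - s x)) s 1
  (fun=> h x - (h y - h x) / (s y - s x) * s x)); split.
- by apply: multiplier_lincomb => //; exact: multiplier_cst.
- by rewrite /lincomb; ring.
- by rewrite /lincomb; field.
Qed.

(** The lattice proof of Stone-Weierstrass: maxima over [y] of interpolants through a fixed [x] give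
    functions above [h - e] on [A] and equal to [h] at [x]; minima of these over [x] also stay below
    [h + e]. *)
Lemma multiplier_approx (A : set X) h (e : R) : compact A -> continuous h ->
  0 < e ->
  exists2 f, multiplier f & forall x, A x -> `|f x - h x| < e.
Proof.
move=> cA hc e0.
have near_gt f x : continuous f -> f x = h x ->
    nbhs x [set y | `|f y - h y| < e].
  move=> fc fx; have : (fun y => f y - h y) @ x --> f x - h x.
    by apply: cvgB; [exact: fc | exact: hc].
  rewrite fx subrr => /cvgrPdist_lt /(_ e e0); apply: filterS => y.
  by rewrite sub0r normrN.
have above x : exists f, [/\ multiplier f, f x = h x &
    forall y, A y -> h y - e < f y].
  apply: (compact_induction (P := fun B => exists f, [/\ multiplier f, f x = h x &
    forall y, B y -> h y - e < f y])) cA _ _ _ _.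
  - by exists (fun=> h x); split=> //; exact: multiplier_cst.
  - move=> B C [f [fA fx fB]] [g [gA gx gC]].
    exists (fun y => Num.max (f y) (g y)); split.
    + exact: multiplier_max.
    + by rewrite fx gx maxxx.
    + by move=> y [/fB|/gC] lt; rewrite lt_max lt ?orbT.
  - move=> B C BC [f [fA fx fB]]; exists f; split=> // y /BC; exact: fB.
  move=> y _; have [f [fA fx fy]] := multiplier_interpolate h x y.
  have [fc _ _] := fA; exists [set z | `|f z - h z| < e]; first exact: near_gt.
  by exists f; split=> // z /=; rewrite ltr_norml; lra.
(* The base case of the second induction needs some multiplier above [h - e], and hence a point. *)
have [->|/set0P[x0 Ax0]] := eqVneq A set0.
  by exists (fun=> 0) => //; exact: multiplier_cst.
have [f [fA fl] fg] : exists2 f, multiplier f /\ (forall y, A y -> h y - e < f y) &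
    forall y, A y -> f y < h y + e.
  apply: (compact_induction (P := fun B => exists2 f, multiplier f /\
    (forall y, A y -> h y - e < f y) & forall y, B y -> f y < h y + e)) cA _ _ _ _.
  - by have [f [fA _ fl]] := above x0; exists f.
  - move=> B C [f [fA fl] fB] [g [gA gl] gC].
    exists (fun y => Num.min (f y) (g y)).
      split; first exact: multiplier_min.
      by move=> y Ay; rewrite lt_min fl ?gl.
    by move=> y [/fB|/gC] lt; rewrite gt_min lt ?orbT.
  - by move=> B C BC [f fA fB]; exists f => // y /BC; exact: fB.
  move=> x _; have [f [fA fx fl]] := above x; have [fc _ _] := fA.
  exists [set z | `|f z - h z| < e]; first exact: near_gt.
  by exists f => // z /=; rewrite ltr_norml; lra.
by exists f => // y Ay; rewrite ltr_norml; have := fl y Ay; have := fg y Ay; lra.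
Qed.

Definition vanishes_at_infinity f : Prop :=
  forall e : R, 0 < e -> exists2 A, compact A & forall x, ~ A x -> `|f x| < e.

(* The multiplier approximating [g / w] on a large compact set is clipped, so
   that its product with [w] stays small off that set. *)
Lemma weighted_stone_weierstrass w g : M w -> (forall x, 0 < w x) ->
  continuous w -> vanishes_at_infinity w ->
  continuous g -> vanishes_at_infinity g -> M g.
Proof.
move=> Mw w0 wc wv gc gv; apply: M_closed => e' e'0.
(* The worst region is [A1] outside [A0], where the error is at most [w * |f - h|] plus twice
   [w * |h|], each bounded by [e]. *)
pose e := e' / 3; have e0 : 0 < e by rewrite divr_gt0.
pose h x := g x / w x.
have hc : continuous h.
  move=> x; apply: cvgM; first exact: gc.
  by apply: cvgV; [rewrite gt_eqF | exact: wc].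
have ghw x : g x = w x * h x by rewrite /h mulrCA divff ?mulr1 ?gt_eqF.
have [A0 cA0 gA0] := gv e e0.
have [C C0 hC] := compact_bounded_fun cA0 hc.
(* Off [A1], any function bounded by the clipping level [C] has product at most [e] with [w]. *)
have [A1 cA1 wA1] := wv (e / C) (divr_gt0 e0 C0).
have [B B0 wB] := M_bounded Mw.
have [f fA fh] := multiplier_approx (compactU cA0 cA1) hc (divr_gt0 e0 B0).
pose t x := Num.max (- C) (Num.min C (f x)).
have tA : multiplier t.
  apply: multiplier_max; first exact: multiplier_cst.
  by apply: multiplier_min => //; exact: multiplier_cst.
have tC x : `|t x| <= C.
  by rewrite ler_norml /t le_max lexx /= ge_max ge_min lexx; lra.
have tf x : `|t x| <= `|f x|.
  rewrite /t; case: (lerP C (f x)) => [Cf|fC].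
    by rewrite max_r ?ger0_norm; lra.
  by case: (lerP (- C) (f x)) => [//|fN]; rewrite normrN gtr0_norm ?ltr0_norm; lra.
(* Clipping projects onto an interval that contains [h x], so it cannot move away from it. *)
have th x : `|h x| <= C -> `|t x - h x| <= `|f x - h x|.
  rewrite ler_norml => /andP[h1 h2]; rewrite /t; case: (lerP C (f x)) => [Cf|fC].
    rewrite max_r; last by lra.
    by rewrite !ger0_norm; lra.
  case: (lerP (- C) (f x)) => [//|fN].
  by rewrite !ler0_norm; lra.
have wfg x : (A0 `|` A1) x -> w x * `|f x - h x| <= e.
  move=> /fh/ltW le; have := wB x; rewrite (gtr0_norm (w0 x)) => leB.
  by rewrite -[leRHS](divfK (lt0r_neq0 B0)) mulrC ler_pM// ltW.
have [_ _ tM] := tA; exists (fun x => t x * w x); first exact: tM.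
move=> x; have -> : `|g x - t x * w x| = w x * `|t x - h x|.
  by rewrite ghw -[in RHS](gtr0_norm (w0 x)) -normrM -normrN; congr `|_|; ring.
have [Ax|nAx0] := pselect (A0 x).
  have := wfg x (or_introl Ax); have := hC x Ax => /th le.
  by have := ler_wpM2l (ltW (w0 x)) le; rewrite /e in e0 *; lra.
have gx := gA0 x nAx0.
have hx : w x * `|h x| < e by rewrite -(gtr0_norm (w0 x)) -normrM -ghw.
have tri : w x * `|t x - h x| <= w x * `|t x| + w x * `|h x|.
  by rewrite -mulrDr ler_wpM2l ?ler_normB// ltW.
have [Ax|nAx1] := pselect (A1 x).
  have := wfg x (or_intror Ax) => le.
  have le2 : w x * `|t x| <= w x * `|f x - h x| + w x * `|h x|.
    rewrite -mulrDr ler_wpM2l ?(ltW (w0 x))// (le_trans (tf x))//.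
    by rewrite -[in leLHS](subrK (h x) (f x)) ler_normD.
  by rewrite /e in le hx; lra.
have : w x * `|t x| <= e.
  have := wA1 x nAx1; rewrite (gtr0_norm (w0 x)) => /ltW lew.
  by rewrite -[leRHS](divfK (lt0r_neq0 C0)) ler_pM// ltW.
by move=> le; rewrite /e in le hx; lra.
Qed.

End WeightedStoneWeierstrass.

(** * The space [C0]: closure properties, real and imaginary parts, separation *)

Section ComplexC0.
Context {R : realType} {X : topologicalType}.
Implicit Types (f g : X -> R[i]).

Lemma normc_triangle (z w : R[i]) :
  Normc.normc (z + w) <= Normc.normc z + Normc.normc w.
Proof. exact: le_normcD. Qed.

Lemma normc_sub_sym (z w : R[i]) : Normc.normc (z - w) = Normc.normc (w - z).
Proof. by rewrite -[RHS]normcN opprB. Qed.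

Lemma normc_ge0 (z : R[i]) : 0 <= Normc.normc z.
Proof. by case: z => a b; exact: sqrtr_ge0. Qed.

Lemma normc_real (a : R) : Normc.normc (a%:C)%C = `|a|.
Proof. by rewrite /= expr0n addr0 sqrtr_sqr. Qed.

Lemma normc_le_ReIm (z : R[i]) :
  Normc.normc z <= `|complex.Re z| + `|complex.Im z|.
Proof.
case: z => a b /=.
rewrite -(ger0_norm (addr_ge0 (normr_ge0 a) (normr_ge0 b))) -sqrtr_sqr ler_wsqrtr//.
rewrite sqrrD !real_normK ?num_real// addrAC lerDl mulrn_wge0// mulr_ge0//.
Qed.

Lemma Re_le_normc (z : R[i]) : `|complex.Re z| <= Normc.normc z.
Proof. by case: z => a b /=; rewrite -sqrtr_sqr ler_wsqrtr// lerDl sqr_ge0. Qed.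

Lemma Im_le_normc (z : R[i]) : `|complex.Im z| <= Normc.normc z.
Proof. by case: z => a b /=; rewrite -sqrtr_sqr ler_wsqrtr// lerDr sqr_ge0. Qed.

Lemma continuous_normcP f : continuous (f : X -> R[i]^o) <->
  forall x (e : R), 0 < e -> nbhs x [set y | Normc.normc (f x - f y) < e].
Proof.
split=> [fc x e e0|H x].
  have e0' : (0 : R[i]) < (e%:C)%C by rewrite ltcR.
  have /cvgrPdist_lt /(_ _ e0') := fc x.
  by apply: filterS => y /=; rewrite -[`|_|]/((Normc.normc (f x - f y))%:C)%C ltcR.
apply/cvgrPdist_lt => -[a b]; rewrite ltcE /= => /andP[/eqP -> a0].
apply: filterS (H x a a0) => y /= lt.
by rewrite -[`|_|]/((Normc.normc (f x - f y))%:C)%C ltcR.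
Qed.

Lemma C0_closed f :
  (forall e : R, 0 < e -> exists2 g, C0 R X g
    & forall x, Normc.normc (f x - g x) <= e) ->
  C0 R X f.
Proof.
move=> H; split.
  apply/continuous_normcP => x e e0; have e3 : 0 < e / 3 by rewrite divr_gt0.
  have [g [/continuous_normcP gc _] fg] := H _ e3.
  apply: filterS (gc x _ e3) => y /= lt.
  have -> : f x - f y = (f x - g x) + ((g x - g y) + (g y - f y)) by ring.
  have := normc_triangle (f x - g x) ((g x - g y) + (g y - f y)).
  have := normc_triangle (g x - g y) (g y - f y).
  have := fg x; have := fg y; rewrite (normc_sub_sym (f y)); lra.
move=> e e0; have e2 : 0 < e / 2 by rewrite divr_gt0.
have [g [_ gv] fg] := H _ e2; have [A cA gA] := gv _ e2; exists A => // x /gA lt.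
have -> : f x = (f x - g x) + g x by ring.
by have := normc_triangle (f x - g x) (g x); have := fg x; lra.
Qed.

Lemma C0_linear (a : R[i]) f g : C0 R X f -> C0 R X g -> C0 R X (a *: f + g).
Proof.
move=> [/continuous_normcP fc fv] [/continuous_normcP gc gv].
pose d := Normc.normc a + 1; have d0 : 0 < d by rewrite ltr_wpDl ?normc_ge0.
have bound z w (e : R) : Normc.normc z < e / (2 * d) -> Normc.normc w < e / 2 ->
    Normc.normc (a * z + w) < e.
  rewrite invfM mulrA ltr_pdivlMr// => zl wl;
    apply: (le_lt_trans (normc_triangle _ _)).
  rewrite Normc.normcM; have : Normc.normc a * Normc.normc z <= Normc.normc z * d.
    by rewrite mulrC ler_wpM2l ?normc_ge0// lerDl.
  by lra.
have pos (e : R) : 0 < e -> 0 < e / (2 * d) /\ 0 < e / 2.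
  by move=> e0; rewrite !divr_gt0// mulr_gt0.
split.
  apply/continuous_normcP => x e /pos[e1 e2].
  apply: filterS2 (fc x _ e1) (gc x _ e2) => y /= lf lg.
  have := bound _ _ _ lf lg; congr (Normc.normc _ < _).
  rewrite -[(a *: f + g) x]/(a * f x + g x) -[(a *: f + g) y]/(a * f y + g y).
  ring.
move=> e /pos[e1 e2]; have [A cA fA] := fv _ e1; have [B cB gB] := gv _ e2.
exists (A `|` B); first exact: compactU.
by move=> x /not_orP[/fA lf /gB lg]; exact: bound.
Qed.

Lemma C0_real (f : X -> R) : continuous f -> vanishes_at_infinity f ->
  C0 R X (fun x => (f x)%:C%C).
Proof.
move=> fc fv; split.
  apply/continuous_normcP => x e e0; have /cvgrPdist_lt /(_ e e0) := fc x.
  by apply: filterS => y lt; rewrite /mkset -(rmorphB (real_complex R)) normc_real.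
move=> e /fv[A cA fA]; exists A => // x /fA; by rewrite normc_real.
Qed.

Lemma C0_re f : C0 R X f -> continuous (re_fun f) /\
  vanishes_at_infinity (re_fun f).
Proof.
move=> [/continuous_normcP fc fv]; split.
  move=> x; apply/cvgrPdist_lt => e e0; apply: filterS (fc x e e0) => y /=.
  by apply: le_lt_trans; rewrite /re_fun -raddfB Re_le_normc.
move=> e /fv[A cA fA]; exists A => // x /fA; exact: le_lt_trans (Re_le_normc _).
Qed.

Lemma C0_im f : C0 R X f -> continuous (im_fun f) /\
  vanishes_at_infinity (im_fun f).
Proof.
move=> [/continuous_normcP fc fv]; split.
  move=> x; apply/cvgrPdist_lt => e e0; apply: filterS (fc x e e0) => y /=.
  by apply: le_lt_trans; rewrite /im_fun -raddfB Im_le_normc.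
move=> e /fv[A cA fA]; exists A => // x /fA; exact: le_lt_trans (Im_le_normc _).
Qed.

Lemma C0_separates (x y : X) : locally_compact [set: X] -> hausdorff_space X ->
  x <> y -> exists2 f : X -> R[i], C0 R X f & f x = 1 /\ f y = 0.
Proof.
move=> lc hs xy; have [U wU [cU _]] := lc x I.
have xU : nbhs x U by apply: filterS (wU : nbhs x [set z | [set: X] z ->
  U z]) => z; apply.
(* A function equal to 1 on [B] and 0 at [x] has a complement to 1 that vanishes at [y] and off the
   compact set [U]. *)
pose B := ~` (U° `&` ~` [set y]).
have cB : closed B.
  apply/open_closedC/openI; first exact: open_interior.
  by apply: closed_openC; apply: accessible_closed_set1;
    exact: hausdorff_accessible.
have nBx : ~ B x by apply; split.
have /(@uniform_separatorP _ R) [f [fc _ f0 f1]] :=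
  @locally_compact_completely_regular X R lc hs _ _ cB nBx.
exists (fun z => (1 - f z)%:C%C).
  apply: C0_real; first by move=> z; apply: cvgB; [exact: cvg_cst | exact: fc].
  move=> e e0; exists U => // z nUz; have Bz : B z by move=> [/interior_subset].
  by rewrite (f1 (f z)) ?subrr ?normr0//; exists z.
split; first by rewrite (f0 (f x)) ?subr0//; exists x.
by rewrite (f1 (f y)) ?subrr//; exists y => // -[_]; apply.
Qed.

End ComplexC0.

(** * Consequences of the RKHS axioms, valid for any space satisfying them *)

Section RKHSConsequences.
Context {R : realType} {T : Type} (K : T -> T -> R[i]).
Variables (H : set (T -> R[i])) (ip : (T -> R[i]) -> (T -> R[i]) -> R[i]).
Hypothesis HK : is_rkhs K H ip.

Lemma rkhs_sum (s : seq (R[i] * T)) : H (\sum_(p <- s) p.1 *: K^~ p.2).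
Proof.
elim: s => [|p s IH]; first by rewrite big_nil; exact: rkhs_zero HK.
by rewrite big_cons; exact: (rkhs_linear HK p.1 (rkhs_kernel HK p.2) IH).
Qed.

Lemma rkhs_sub F G : H F -> H G -> H (F - G).
Proof.
move=> HF HG; rewrite addrC -scaleN1r.
exact: (rkhs_linear HK (-1) HG HF).
Qed.

Lemma rkhs_ip0 F : H F -> ip 0 F = 0.
Proof.
move=> HF; have H0 := rkhs_zero HK.
by have := rkhs_ip_linear HK (-1) H0 H0 HF; rewrite scaler0 addr0 mulN1r addNr.
Qed.

Lemma rkhs_ip_sum (s : seq (R[i] * T)) G : H G ->
  ip (\sum_(p <- s) p.1 *: K^~ p.2) G = \sum_(p <- s) p.1 * (G p.2)^*%C.
Proof.
move=> HG; elim: s => [|p s IH]; first by rewrite !big_nil rkhs_ip0.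
have Hp := rkhs_kernel HK p.2.
rewrite !big_cons (rkhs_ip_linear HK _ Hp (rkhs_sum s) HG) IH.
by rewrite (rkhs_ip_conj HK HG Hp) (rkhs_reproducing HK).
Qed.

Lemma rkhs_positive_definite : positive_definite K.
Proof.
(* The coefficients are conjugated because the inner product of [K^~ y] with [K^~ x] is [K x y],
   with the points exchanged. *)
move=> n x c _; pose s := [seq ((c i)^*%C, x i) | i <- enum 'I_n].
have := rkhs_ip_ge0 HK (rkhs_sum s); rewrite rkhs_ip_sum; last exact: rkhs_sum.
congr (_ <= _); rewrite big_map [RHS]exchange_big -big_enum;
  apply: eq_bigr => i _ /=.
rewrite fct_sumE rmorph_sum mulr_sumr big_map -big_enum; apply: eq_bigr => j _ /=.
rewrite -[((c j)^*%C *: K^~ (x j)) (x i)]/((c j)^*%C * K (x i) (x j)) rmorphM /=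
  conjcK.
rewrite -[K (x i) (x j)](rkhs_reproducing HK (x i) (rkhs_kernel HK (x j))).
rewrite -(rkhs_ip_conj HK (rkhs_kernel HK _) (rkhs_kernel HK _)).
by rewrite (rkhs_reproducing HK (x j) (rkhs_kernel HK (x i))) mulrCA mulrA.
Qed.

Lemma rkhs_ip_scale_add F G (a : R[i]) : H F -> H G ->
  ip (a *: G + F) (a *: G + F) =
  ip F F + a * ip G F + a^*%C * ip F G + a * a^*%C * ip G G.
Proof.
move=> HF HG; have HE := rkhs_linear HK a HG HF.
have right E : H E -> ip E (a *: G + F) = a^*%C * (ip G E)^*%C + (ip F E)^*%C.
  by move=> HE'; rewrite (rkhs_ip_conj HK HE HE') (rkhs_ip_linear HK)// rmorphD
    rmorphM.
rewrite (rkhs_ip_linear HK)// !right// -!(rkhs_ip_conj HK)//; ring.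
Qed.

Lemma rkhs_eval_le F x : 0 < K x x <= 1 -> H F -> Normc.normc (F x) <= ip_norm ip F.
Proof.
move=> /andP[k0 k1] HF; have Hk := rkhs_kernel HK x.
have kE : ip (K^~ x) (K^~ x) = K x x by rewrite (rkhs_reproducing HK).
have FE : ip (K^~ x) F = (F x)^*%C by rewrite (rkhs_ip_conj HK HF Hk)
  (rkhs_reproducing HK).
(* This [a] minimizes the norm of [a *: K^~ x + F]; nonnegativity there is Cauchy-Schwarz. *)
pose a := - F x / K x x.
have := rkhs_ip_ge0 HK (rkhs_linear HK a Hk HF).
have kr : (K x x)^*%C = K x x.
  by move: k0; rewrite ltcE; case: (K x x) => u v /= /andP[/eqP -> _];
    rewrite oppr0.
have kn0 : K x x != 0 by rewrite gt_eqF.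
rewrite rkhs_ip_scale_add// kE FE (rkhs_reproducing HK)//.
have -> : a^*%C = - (F x)^*%C / K x x by rewrite rmorphM fmorphV rmorphN /= kr.
rewrite /a.
rewrite [X in 0 <= X](_ : _ = ip F F - F x * (F x)^*%C / K x x); last by field.
rewrite subr_ge0 ler_pdivrMr// => le.
have ipk : ip F F * K x x <= ip F F by rewrite ler_piMr// (rkhs_ip_ge0 HK).
have := le_trans le ipk; rewrite -sqr_normc.
rewrite -[`|F x|]/((Normc.normc (F x))%:C)%C -rmorphXn lecE => /andP[_ /=] le'.
by rewrite /ip_norm -(ger0_norm (normc_ge0 (F x))) -sqrtr_sqr ler_wsqrtr.
Qed.

(* The Gram matrix of [K^~ x] and [K^~ y] is singular, so these two vectors are
   proportional. *)
Lemma rkhs_proportional x y (a b c : R) : K x x = a%:C%C -> K y y = b%:C%C ->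
  K x y = c%:C%C -> 0 < b -> a * b <= c ^+ 2 ->
  forall F, H F -> F x = (c / b)%:C%C * F y.
Proof.
move=> Ka Kb Kc b0 abc F HF.
have Hx := rkhs_kernel HK x; have Hy := rkhs_kernel HK y.
pose d := - (c / b).
pose E := (d%:C)%C *: K^~ y + K^~ x.
have HE : H E := rkhs_linear HK _ Hy Hx.
have yx : ip (K^~ y) (K^~ x) = c%:C%C by rewrite (rkhs_reproducing HK).
have EE : ip E E = (a - c ^+ 2 / b)%:C%C.
  rewrite rkhs_ip_scale_add// (rkhs_ip_conj HK Hy Hx) yx !conjc_real.
  rewrite !(rkhs_reproducing HK)// Ka Kb -!rmorphM -!rmorphD /=.
  by congr (_%:C)%C; rewrite /d; field; rewrite gt_eqF.
have E0 : E = 0.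
  apply: (rkhs_ip_eq0 HK HE); apply/eqP;
    rewrite eq_le (rkhs_ip_ge0 HK HE) andbT EE lecR.
  by rewrite subr_le0 ler_pdivlMr.
have := rkhs_ip0 HF; rewrite -{1}E0 (rkhs_ip_linear HK)//.
rewrite (rkhs_ip_conj HK HF Hy) (rkhs_ip_conj HK HF Hx) !(rkhs_reproducing HK)//.
move=> /(congr1 (fun z => z^*%C)); rewrite rmorphD rmorphM /= oppr0 !conjcK.
move=> /eqP; rewrite addrC addr_eq0 => /eqP ->.
rewrite -mulNr; congr (_ * _); apply/eqP.
by rewrite eq_complex /= /d opprK oppr0 !eqxx.
Qed.

End RKHSConsequences.

(** * The uniform closure of the span of the kernel sections *)

Section UniformSpan.
Context {R : realType} {X : Type} (K : X -> X -> R).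
Hypothesis K_le1 : forall x y, `|K x y| <= 1.

Definition uniform_span : set (X -> R) :=
  [set f | forall e : R, 0 < e -> exists s, forall x, `|f x - combo K s x| <= e].

Lemma uniform_span_closed f :
  (forall e : R, 0 < e -> exists2 g, uniform_span g & forall x, `|f x - g x| <=
    e) ->
  uniform_span f.
Proof.
move=> H e e0; have e2 : 0 < e / 2 by rewrite divr_gt0.
have [g gM fg] := H _ e2; have [s gs] := gM _ e2; exists s => x.
rewrite -(subrK (g x) (f x)) -addrA (le_trans (ler_normD _ _))//.
by have := fg x; have := gs x; lra.
Qed.

Lemma uniform_span_linear a f b g :
  uniform_span f -> uniform_span g -> uniform_span (lincomb a f b g).
Proof.
have scale c h (e : R) : uniform_span h -> 0 < e ->
    exists s, forall x, `|c * h x - combo K (scale_combo c s) x| <= e.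
  move=> hM e0; have c0 : 0 < `|c| + 1 by rewrite ltr_wpDl.
  have [s hs] := hM _ (divr_gt0 e0 c0); exists s => x.
  rewrite combo_scale -mulrBr normrM; have := hs x; rewrite ler_pdivlMr// => le.
  by have := normr_ge0 (h x - combo K s x); lra.
move=> fM gM e e0; have e2 : 0 < e / 2 by rewrite divr_gt0.
have [s fs] := scale a f _ fM e2; have [t gt] := scale b g _ gM e2.
exists (scale_combo a s ++ scale_combo b t) => x.
rewrite combo_cat /lincomb opprD addrACA (le_trans (ler_normD _ _))//.
by have := fs x; have := gt x; lra.
Qed.

Lemma uniform_span_bounded f : uniform_span f ->
  exists2 C, 0 < C & forall x, `|f x| <= C.
Proof.
move=> /(_ 1 ltr01)[s fs]; exists (\sum_(p <- s) `|p.1| + 1).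
  by rewrite ltr_wpDl// sumr_ge0.
move=> x; rewrite -(subrK (combo K s x) (f x)) addrC (le_trans (ler_normD _ _))//.
rewrite lerD// (le_trans (ler_norm_sum _ _ _))// ler_sum// => p _.
by rewrite normrM ler_piMr.
Qed.

Lemma uniform_span_combo f (s : seq (R * X)) :
  (forall y, uniform_span (fun x => f x * K x y)) ->
  uniform_span (fun x => f x * combo K s x).
Proof.
move=> fK; elim: s => [|p s IH].
  by move=> e e0; exists [::] => x; rewrite !combo_nil mulr0 subr0 normr0 ltW.
have := uniform_span_linear p.1 1 (fK p.2) IH; congr uniform_span;
  apply/funext => x.
by rewrite /lincomb /combo big_cons; ring.
Qed.

Hypothesis Kpd : pd_kernel K.

Lemma real_rkhs_uniform_span f : real_rkhs K f -> uniform_span f.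
Proof.
move=> fR e e0; have [s [Rs lt]] := combo_dense Kpd fR (exprn_gt0 2 e0).
exists s => x; have := sqr_eval_le Kpd x Rs; rewrite /lincomb mul1r mulN1r => le.
rewrite -(ler_pXn2r (n := 2)) ?nnegrE ?normr_ge0 ?(ltW e0)// real_normK ?num_real//.
apply: (le_trans le); apply: le_trans (ltW lt).
by rewrite ler_piMr ?sqnorm_ge0// (le_trans (ler_norm _)).
Qed.

End UniformSpan.

(** The form with weight -1 at [None] is [K None None] minus the value tested at [s]; its
    nonnegativity is the required upper bound. *)
Lemma real_rkhs_extension {R : realType} {X : Type} (K : option X -> option X ->
  R) :
  pd_kernel K ->
  real_rkhs (fun x y => K (Some x) (Some y)) (fun x => K (Some x) None).
Proof.
move=> [Ksym K0].
apply: (sqnorm_le (c := K None None) _).1 => s.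
pose t : seq (R * option X) := [seq (p.1, Some p.2) | p <- s].
have := K0 ((-1, None) :: t); rewrite -cat1s form_catl !form_catr form_eval.
rewrite (form_sym Ksym [:: _] t).
have -> : form K t t = form (fun x y => K (Some x) (Some y)) s s.
  by rewrite !form_sum big_map; apply: eq_bigr => p _; rewrite big_map.
have -> : form K t [:: (-1, None)] = - pairing (fun x => K (Some x) None) s.
  rewrite form_sum big_map -sumrN; apply: eq_bigr => p _.
  by rewrite big_seq1 /=; ring.
lra.
Qed.

(** * The kernel [1 / L]: sine multipliers, separation, comparison of sections *)

Section LogConditionalKernels.
Context {R : realType} {X : topologicalType} (L : X -> X -> R).
Hypothesis L_cont : continuous (fun p : X * X => L p.1 p.2).
Hypothesis L_log : log_conditional L.

Let g := log_kernel L.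
Let K x y : R := (L x y)^-1.

Lemma log_conditional_gt0 x y : 0 < L x y.
Proof. by have [L1 _ _] := L_log; exact: lt_le_trans ltr01 (L1 x y). Qed.

Lemma inverse_expR x y : K x y = expR (- g x y).
Proof. by rewrite expRN /g /log_kernel lnK// posrE log_conditional_gt0. Qed.

Lemma inverse_in01 x y : 0 < K x y <= 1.
Proof.
have [L1 _ _] := L_log.
by rewrite invr_gt0 log_conditional_gt0 invf_le1 ?log_conditional_gt0 ?L1.
Qed.

Lemma inverse_norm_le1 x y : `|K x y| <= 1.
Proof. by have /andP[/ltW K0 K1] := inverse_in01 x y; rewrite ger0_norm. Qed.

Lemma inverse_pd : pd_kernel K.
Proof.
have [_ _ /pd_exp_opp] := L_log; congr pd_kernel.
by apply/funext => x; apply/funext => y; rewrite inverse_expR.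
Qed.

Lemma inverse_continuous y : continuous (K^~ y).
Proof.
move=> x; apply: cvgV; first by rewrite gt_eqF ?log_conditional_gt0.
apply: (@continuous2_cvg _ _ _ _ (nbhs x) _ id (fun=> y) L x y);
  first exact: (@L_cont (x, y)).
  exact: cvg_id.
exact: cvg_cst.
Qed.

Lemma log_kernel_continuous y : continuous (g^~ y).
Proof.
have <- : (fun x => - ln (K x y)) = g^~ y.
  by apply/funext => z; rewrite inverse_expR expRK opprK.
move=> x; apply: cvgN.
apply: cvg_comp; first exact: inverse_continuous.
by apply: continuous_ln; have /andP[] := inverse_in01 x y.
Qed.

Lemma sin_multiplier (x y : X) (t d : R) :
  multiplier (uniform_span K) (fun u => sin (t * (g u x - g u y) + d)).
Proof.
have sc : continuous (fun u => sin (t * (g u x - g u y) + d)).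
  move=> u; apply: cvg_comp; last exact: continuous_sin.
  apply: cvgD; last exact: cvg_cst.
  by apply: cvgMl_tmp; apply: cvgB; exact: log_kernel_continuous.
have s1 u : `|sin (t * (g u x - g u y) + d)| <= 1.
  by rewrite ler_norml sin_geN1 sin_le1.
split=> //; first by exists 1.
have Kpd := inverse_pd.
have zM z : uniform_span K (fun u => sin (t * (g u x - g u y) + d) * K u z).
  apply: real_rkhs_uniform_span => //; first exact: inverse_norm_le1.
  have [_ _ gcnd] := L_log; have [C /real_rkhs_extension] :=
    pd_exp_opp_sin z x y t d gcnd.
  have -> : (fun u => sin (t * (g u x - g u y) + d) * K u z) =
      (fun u => expR (- log_kernel L u z) *
        sin (t * (log_kernel L u x - log_kernel L u y) + d)).
    by apply/funext => u; rewrite inverse_expR mulrC.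
  have <- // : K = (fun u v => expR (- log_kernel L u v)).
  by apply/funext => u; apply/funext => v; rewrite inverse_expR.
(* From kernel sections to all of the closure: multiplying by a function bounded by 1 does not
   increase the approximation error. *)
move=> m mM; apply: uniform_span_closed => e e0; have [s ms] := mM e e0.
exists (fun u => sin (t * (g u x - g u y) + d) * combo K s u).
  exact: uniform_span_combo.
by move=> u; rewrite -mulrBr normrM (le_trans (ler_piMl _ (s1 u))).
Qed.

(** Metrizability says that [u |-> g u x - g u y] takes different values [a] at [x] and [b] at [y].
    The affine rescaling sends these to 0 and 1, where sine differs since 0 < 1 < pi. *)
Lemma multiplier_separates_points : log_metrizable L -> forall x y, x <> y ->
  exists2 f, multiplier (uniform_span K) f & f x <> f y.
Proof.
move=> met x y /(met x y); rewrite -/g => lt.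
have [_ _ [gsym _]] := L_log.
pose a := g x x - g x y; pose b := g y x - g y y.
have ba : 0 < b - a by rewrite /a /b /g (gsym y x) -/g; lra.
exists (fun u => sin ((b - a)^-1 * (g u x - g u y) + - ((b - a)^-1 * a))).
  exact: sin_multiplier.
rewrite -/a -/b subrr sin0 -mulrBr mulVf ?gt_eqF// => /esym/eqP.
by rewrite gt_eqF// sin_gt0_pi// ltr01 (lt_le_trans _ (pi_ge2 _))// ltr1n.
Qed.

(* [L x y <= L x z ^ 2 * L z y ^ 2] is negative definiteness for the weights
   [1, -2, 1] at [x, z, y]. *)
Lemma inverse_basepoint x y z : K x z ^+ 2 <= L z y ^+ 2 * K x y.
Proof.
have [L1 _ gcnd] := L_log; have gsym := gcnd.1.
have := @cond_neg_def_combo _ _ g [:: (1, x); (-2, z); (1, y)] gcnd.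
rewrite !big_cons big_nil /= addr0 (_ : 1 + (-2 + 1) = 0); last by ring.
move=> /(_ erefl); rewrite form_sum !big_cons !big_nil /=.
rewrite /g (gsym z x) (gsym y x) (gsym y z) -/g => le.
(* [1 <= L] allows the diagonal terms to be dropped. *)
have pos u v : 0 <= g u v by apply: ln_ge0.
have ge := pos x x; have ge' := pos y y; have ge'' := pos z z.
have -> : L z y ^+ 2 = expR (2 * g z y).
  by rewrite mulrC expRM_natr /g /log_kernel lnK// posrE log_conditional_gt0.
rewrite !inverse_expR -expRM_natr -expRD ler_expR; lra.
Qed.

Lemma complex_inverse_is_rkhs :
  exists ip, is_rkhs (inverse_kernel L) (rkhs (inverse_kernel L)) ip.
Proof.
apply: (@xgetPex _ set0 [set H | exists ip, is_rkhs (inverse_kernel L) H ip]).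
by exists (complex_rkhs K), (complex_ip K); exact: complex_rkhs_is_rkhs inverse_pd.
Qed.

End LogConditionalKernels.

(** * Both equivalences *)

Section Universality.
Context {R : realType} {X : topologicalType} (L : X -> X -> R).
Hypothesis L_cont : continuous (fun p : X * X => L p.1 p.2).
Hypothesis L_log : log_conditional L.

Let K x y : R := (L x y)^-1.

Lemma inverse_vanishes (y z : X) : vanishes_at_infinity (K^~ y) ->
  vanishes_at_infinity (K^~ z).
Proof.
move=> yv e e0; have Lzy := log_conditional_gt0 L_log z y.
have [|A cA yA] := yv (e ^+ 2 / L z y ^+ 2); first by rewrite divr_gt0 ?exprn_gt0.
exists A => // x /yA; have /andP[Kxy0 _] := inverse_in01 L_log x y.
have /andP[Kxz0 _] := inverse_in01 L_log x z.
rewrite gtr0_norm// ltr_pdivlMr ?exprn_gt0// mulrC => lt.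
rewrite gtr0_norm// -(ltr_pXn2r (n := 2)) ?nnegrE ?(ltW e0) ?(ltW Kxz0)//.
exact: le_lt_trans (inverse_basepoint L_log x y z) lt.
Qed.

(** One section in [C0] gives all of them. As the diagonal of the kernel is at most 1, the RKHS norm
    dominates the uniform one, so density of the finite sums and closedness of [C0] conclude. *)
Lemma rkhs_sub_C0 (y : X) : C0 R X (fun x => inverse_kernel L x y) ->
  rkhs (inverse_kernel L) `<=` C0 R X.
Proof.
move=> /C0_re[_ yv] F HF; have [ip HK] := complex_inverse_is_rkhs L_log.
have kC0 z : C0 R X (inverse_kernel L ^~ z).
  apply: C0_real; first exact: inverse_continuous.
  exact: inverse_vanishes yv.
apply: C0_closed => e e0; have [n [a [z lt]]] := rkhs_dense HK HF e0.
pose s := [seq (a i, z i) | i <- enum 'I_n].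
have sE : \sum_i a i *: (inverse_kernel L)^~ (z i) =
  \sum_(p <- s) p.1 *: (inverse_kernel L)^~ p.2.
  by rewrite big_map -big_enum.
exists (\sum_(p <- s) p.1 *: (inverse_kernel L)^~ p.2).
  elim: {sE} s => [|p s IH].
    rewrite big_nil; apply: (C0_real (f := fun=> 0)) => [x|e' e'0];
      first exact: cvg_cst.
    by exists set0 => [|x _]; [exact: compact0 | rewrite normr0].
  by rewrite big_cons; exact: C0_linear.
move=> x; rewrite -sE in lt *; apply: le_trans (ltW lt).
apply: (rkhs_eval_le HK (x := x)).
  by rewrite ltcR lecR inverse_in01.
by apply: (rkhs_sub HK HF); rewrite sE; exact: rkhs_sum HK s.
Qed.

Lemma universal_of_metrizable (z : X) : log_metrizable L ->
  rkhs (inverse_kernel L) `<=` C0 R X -> C0_universal (inverse_kernel L).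
Proof.
move=> met HC0; have [ip HK] := complex_inverse_is_rkhs L_log.
split=> //; first exact: rkhs_positive_definite HK.
move=> f e Cf e0.
have [wc wv] := C0_re (HC0 _ (rkhs_kernel HK z)).
have dense h : continuous h -> vanishes_at_infinity h -> uniform_span K h.
  have Kle1 := inverse_norm_le1 L_log.
  apply: (weighted_stone_weierstrass (uniform_span_linear (K := K))
    (@uniform_span_closed _ _ K) (uniform_span_bounded Kle1)
    (multiplier_separates_points L_cont L_log met) _ _ wc wv).
    apply: real_rkhs_uniform_span => //; first exact: inverse_pd.
    exact: (real_rkhs_kernel (inverse_pd L_log) z).1.
  by move=> x; have /andP[] := inverse_in01 L_log x z.
(* Two errors of [e / 4], for the real and imaginary parts, leave the supremum at most [e / 2],
   strictly below [e]. *)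
have e4 : 0 < e / 4 by rewrite divr_gt0.
have [rc rv] := C0_re Cf; have [ic iv] := C0_im Cf.
have [s fs] := dense _ rc rv _ e4; have [t ft] := dense _ ic iv _ e4.
have Hh := rkhs_sum HK ([seq (p.1%:C%C, p.2) | p <- s] ++
  [seq (Complex 0 p.1, p.2) | p <- t]).
have hE := complex_combo_eval K s t.
set h := \sum_(p <- _) _ in Hh hE; exists h => //.
apply: (@le_lt_trans _ _ (e / 2)%:E); last by rewrite lte_fin; lra.
apply: ge_ereal_sup => _ [x _ <-]; rewrite lee_fin.
apply: (le_trans (normc_le_ReIm _)); rewrite !raddfB hE /=.
have := fs x; have := ft x; rewrite /re_fun /im_fun.
by rewrite (distrC (complex.Im _)) (distrC (complex.Re _)); lra.
Qed.

Lemma metrizable_of_universal : locally_compact [set: X] -> hausdorff_space X ->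
  C0_universal (inverse_kernel L) -> log_metrizable L.
Proof.
move=> lc hs [_ _ dense] x y xy; rewrite ltNge; apply/negP => le.
have [ip HK] := complex_inverse_is_rkhs L_log.
have /andP[Kyy0 _] := inverse_in01 L_log y y.
pose c := K x y / K y y.
have prop F : rkhs (inverse_kernel L) F -> F x = c%:C%C * F y.
  apply: (rkhs_proportional HK (a := K x x)) => //.
  (* Failure of metrizability at [x], [y], exponentiated, says that the Gram determinant is
     nonpositive. *)
  rewrite /K !inverse_expR// -expRM_natr -expRD ler_expR; lra.
have [f Cf [fx fy]] := @C0_separates R X x y lc hs xy.
have c0 : 0 < `|c| + 1 by rewrite ltr_wpDl.
(* The tolerance [1 / (|c| + 1)] is contradictory: since [h x = c * h y], [f x = 1] and [f y = 0],
   the number 1 is at most the error at [x] plus [|c|] times the error at [y]. *)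
have [h Hh hf] := dense f _ Cf (divr_gt0 ltr01 c0).
have lt u : Normc.normc (h u - f u) < 1 / (`|c| + 1).
  rewrite -lte_fin; apply: le_lt_trans hf; apply: ereal_sup_ubound.
  by exists u.
have := lt x; have := lt y; rewrite fx fy subr0 (prop h Hh) => lty ltx.
have : 1 <= Normc.normc (c%:C%C * h y - 1) + Normc.normc (c%:C%C * h y).
  have := normc_triangle (1 - c%:C%C * h y) (c%:C%C * h y).
  by rewrite subrK Normc.normc1 normc_sub_sym.
rewrite Normc.normcM normc_real; rewrite !ltr_pdivlMr// in ltx lty.
set p := Normc.normc (_ - _) in ltx *; set q := Normc.normc _ in lty *.
move=> /(ler_wpM2r (ltW c0)); have := ler_wpM2l (normr_ge0 c) (ltW lty); lra.
Qed.

End Universality.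

Unset Implicit Arguments.

Theorem theorem6p5 (R : realType) (X : topologicalType) (L : X -> X -> R)
  (X_nonempty : [set: X] !=set0)
  (X_locally_compact : locally_compact [set: X])
  (X_hausdorff : hausdorff_space X)
  (L_continuous : continuous (fun p : X * X => L p.1 p.2))
  (L_log_conditional : log_conditional L) :
  (C0_universal (inverse_kernel L) <->
     log_metrizable L /\ rkhs (inverse_kernel L) `<=` C0 R X) /\
  ((exists z0 : X, C0 R X (fun x => inverse_kernel L x z0)) <->
     rkhs (inverse_kernel L) `<=` C0 R X).
Proof.
(* [z] is the base point of the weight in the density argument, and the witness [z0] in the last
   implication. *)
have [z _] := X_nonempty; split; split.
- by move=> U; split; [exact: metrizable_of_universal U | case: U].
- by move=> [met HC0]; exact: universal_of_metrizable.
- by move=> [y]; exact: rkhs_sub_C0.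
have [ip HK] := complex_inverse_is_rkhs L_log_conditional.
by move=> HC0; exists z; apply: HC0; exact: rkhs_kernel HK z.
Qed.
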